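(* Let $n\ge 1$, let $Z$ be an $n$-dimensional standard Gaussian random vector, let $f:\mathbb R^n\to\mathbb R$ be a convex function with $f\in L_2(\gamma_n)$, and let $M$ be a median of $f(Z)$. Then, for all $t>0$, $$\mathbb P\left( f(Z)-M <-t \right) \leq \frac{1}{2} \exp \left( -\frac{\pi}{1024}\, \frac{t^2}{{\rm Var}[f(Z)]} \right).$$
   Context: $\gamma_n$ denotes the standard Gaussian measure on $\mathbb R^n$, i.e. the law of $Z\sim N(\mathbf 0,I_n)$. A median of a real random variable $Y$ is a number $M$ with $\mathbb P(Y\le M)\ge 1/2$ and $\mathbb P(Y\ge M)\ge 1/2$. *)

(* Defs.v *)
From HB Require Import structures.
From mathcomp Require Import all_boot all_order all_algebra.
From mathcomp Require Import all_classical all_reals all_analysis.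

Set Implicit Arguments.
Unset Strict Implicit.
Unset Printing Implicit Defensive.

Import Order.TTheory GRing.Theory Num.Theory.
Import numFieldNormedType.Exports.

Local Open Scope classical_set_scope.
Local Open Scope ring_scope.

Definition measure_rV_display : measure_display.
Proof. exact. Qed.

(* The sigma-algebra on R^n is the one generated by the coordinate maps,
   i.e. the Borel sigma-algebra. *)
Section measurable_rV.
Variables (R : realType) (n : nat).

Definition rV_coord (i : 'I_n) (v : 'rV[R]_n) : R := v ord0 i.

Let rV_set0 : g_sigma_preimage rV_coord set0.
Proof. exact: sigma_algebra0. Qed.

Let rV_setC A : g_sigma_preimage rV_coord A -> g_sigma_preimage rV_coord (~` A).
Proof. exact: sigma_algebraC. Qed.

Let rV_bigcup (F : _^nat) : (forall i, g_sigma_preimage rV_coord (F i)) ->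
  g_sigma_preimage rV_coord (\bigcup_i (F i)).
Proof. exact: sigma_algebra_bigcup. Qed.

HB.instance Definition _ := @isMeasurable.Build measure_rV_display
  'rV[R]_n (g_sigma_preimage rV_coord) rV_set0 rV_setC rV_bigcup.

End measurable_rV.

Lemma measurable_rV_coord (R : realType) n (i : 'I_n) :
  measurable_fun [set: 'rV[R]_n] (@rV_coord R n i).
Proof.
move=> _ Y mY; rewrite setTI; apply: sub_sigma_algebra => /=.
rewrite -bigcup_seq/=; exists i => /=; first by rewrite mem_index_enum.
by exists Y => //; rewrite setTI.
Qed.

Lemma measurable_fun_rV (R : realType) n d (T : measurableType d)
    (f : T -> 'rV[R]_n) :
  (forall i, measurable_fun [set: T] (rV_coord i \o f)) ->
  measurable_fun [set: T] f.
Proof.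
move=> mf _ A mA.
suff : g_sigma_preimage (fun i => rV_coord i \o f) `<=` measurable.
  move=> h; apply: h; rewrite g_sigma_preimage_comp.
  by exists A.
apply: smallest_sub; first exact: sigma_algebra_measurable.
clear A mA; case: n f mf => [|m] g mg; first by rewrite big_ord0.
rewrite -bigcup_mkord_ord; apply: bigcup_sub => i Ii.
by move=> A [B mB <-]; exact: mg.
Qed.

Section std_gaussian.
Variable R : realType.

(* measurableTypeR R is R with its Borel sigma-algebra, the type on which
   normal_prob is a measure. *)
Definition cons_rV (n : nat) (xv : measurableTypeR R * 'rV[R]_n) : 'rV[R]_n.+1 :=
  \row_i (if unlift ord0 i is Some j then xv.2 ord0 j else xv.1).

Lemma measurable_cons_rV n : measurable_fun [set: measurableTypeR R * 'rV[R]_n]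
  (@cons_rV n).
Proof.
apply: measurable_fun_rV => i.
have [j ->|->] := unliftP ord0 i.
- rewrite (_ : _ \o _ = rV_coord j \o snd).
    by apply: measurableT_comp => //; exact: measurable_rV_coord.
  by apply/funext => x /=; rewrite /rV_coord mxE liftK.
- rewrite (_ : _ \o _ = fst) //.
  by apply/funext => x /=; rewrite /rV_coord mxE unlift_none.
Qed.

HB.instance Definition _ n := @isMeasurableFun.Build _ _ _ _
  (@cons_rV n) (@measurable_cons_rV n).

(* The standard Gaussian measure on R^n, as the n-fold product of N(0, 1). *)
Fixpoint std_gaussian (n : nat) : probability 'rV[R]_n R :=
  if n is n'.+1 then
    distribution (normal_prob (0 : R) 1 \x std_gaussian n')%E (@cons_rV n')
  else dirac (0 : 'rV[R]_0).

Lemma measurable_rV_box n (A : 'I_n -> set R) :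
  (forall i, measurable (A i)) ->
  measurable [set v : 'rV[R]_n | forall i, A i (v ord0 i)].
Proof.
move=> mA.
rewrite (_ : [set _ | _] =
    \bigcap_(i in [set: 'I_n]) (@rV_coord R n i @^-1` A i)).
  apply: fin_bigcap_measurable => // i _.
  by rewrite -[X in measurable X]setTI; exact: measurable_rV_coord.
by apply/seteqP; split => v /= h i; [move=> _; exact: h|exact: (h i I)].
Qed.

Lemma std_gaussian_box n (A : 'I_n -> set R) :
  (forall i, measurable (A i)) ->
  std_gaussian n [set v | forall i, A i (v ord0 i)] =
  (\prod_(i < n) normal_prob (0 : R) 1 (A i))%E.
Proof.
elim: n A => [|n IH] A mA.
  by rewrite big_ord0 /= diracE mem_set// => -[].
rewrite big_ord_recl -IH; last by move=> i; exact: mA.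
rewrite -product_measure1E; [|exact: mA|
  by apply: (@measurable_rV_box _ (fun i => A (lift ord0 i))) => i; exact: mA].
rewrite /= /distribution /pushforward; congr (_ _).
apply/seteqP; split => [[x v]|[x v]] /=.
- move=> h; split; first by move: (h ord0); rewrite mxE unlift_none.
  by move=> i; move: (h (lift ord0 i)); rewrite mxE liftK.
- move=> [h0 h] i; rewrite mxE.
  by have [j ->|->] := unliftP ord0 i.
Qed.

(* Only measurable events are compared: the value of a measure on a
   non-measurable set carries no information. *)
Definition std_gaussian_vector d (T : measurableType d) (P : probability T R)
    (n : nat) (Z : {RV P >-> 'rV[R]_n}) : Prop :=
  forall A : set 'rV[R]_n, measurable A -> distribution P Z A = std_gaussian n A.

End std_gaussian.

Section median.
Local Open Scope ereal_scope.

Definition is_median d (T : measurableType d) (R : realType)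
    (P : probability T R) (Y : T -> R) (M : R) : Prop :=
  (2^-1)%:E <= P [set x | (Y x <= M)%R] /\
  (2^-1)%:E <= P [set x | (Y x >= M)%R].

End median.

(* Main.v *)
Require Import Defs.
From HB Require Import structures.
From mathcomp Require Import all_boot all_order all_algebra.
From mathcomp Require Import all_classical all_reals all_analysis.
From mathcomp Require Import measurable_realfun ring lra.

Set Implicit Arguments.
Unset Strict Implicit.
Unset Printing Implicit Defensive.

Import Order.TTheory GRing.Theory Num.Theory.
Import numFieldNormedType.Exports.

Local Open Scope classical_set_scope.
Local Open Scope ring_scope.

(** The lower tail of a convex function [f] of a Gaussian vector is sub-Gaussian
    at the scale of its standard deviation. The proof rests on one inequality
    for the Gaussian measure [G] and [0 < d < 1], where [p = exp (- h)] and
    [q = exp (- V)] with [h], [V] and [k] nonnegative and [V] convex: if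
    [h ((1 - d) x + d y) <= k x + d ^ 2 V y] for all [x] and [y], then
    [- ln (\int p) <= \int k - d ^ 2 ln (\int q)] ([three_functions]).

    On the line, let [T] be the increasing map that transports [G] to the
    probability proportional to [q G], and [S x = (1 - d) x + d (T x)].
    Substituting [S] in [\int p] and using Jensen's inequality, the claim reduces
    to [\int (ln S' - d ^ 2 ln T' - (d - d ^ 2) x (T x - x)) dG >= 0]. Log-concavity
    of [q] makes [T] a contraction ([gauss_contraction]), and
    for [0 < T' <= 1] one has
    [ln S' - d ^ 2 ln T' >= (d - d ^ 2) (T' - 1)] ([ln_interpolation]); finally
    [T' - 1 - x (T x - x)] integrates to a boundary term at infinity since its
    product with the Gaussian density is a derivative. The dimension is raised by
    integrating one coordinate at a time; the hypothesis on [q] survives because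
    marginals of log-concave functions are log-concave
    ([log_concave_std_gaussian]), which on the line is again proved by monotone
    transport ([prekopa_line]).

    Let [g] be the positive part of [f - (M - t)]. With [h = th g],
    [k = th (1 - d) g] and [V = th g / d] the hypothesis of [three_functions] is
    the convexity of [g], so that the Laplace transform of [g] at the large
    parameter [th / d] is controlled by the one at the small parameter [th], where
    a second order expansion brings in only the second moment of [f - M]. Since
    [exp (- th g / d) = 1] where [f < M - t], this bounds the probability of
    that event ([lower_tail_far]) when [t] is a large multiple of
    [b = sqrt (E (f - M) ^ 2)]. For smaller [t] the factor [1/2] must be kept: there
    the distribution function of [f] is log-concave, at most [1/2] to the left of
    [M] and at least [3/4] at [M + 2 b], which forces it to decrease
    exponentially to the left of [M] ([lower_tail_near]). Finally [b ^ 2] is at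
    most six times the variance ([sqr_dev_median_le]). *)

(** * Change of variables on the line *)

Section density.
Import HBNNSimple.
Local Open Scope ereal_scope.

(** For simple functions this is linearity; the general case follows by
    monotone convergence along simple approximations. *)
Lemma ge0_integral_density d (T : measurableType d) (R : realType)
    (mu nu : {measure set T -> \bar R}) (g : T -> R) :
  measurable_fun setT g -> (forall x, (0 <= g x)%R) ->
  (forall A, measurable A -> nu A = \int[mu]_(x in A) (g x)%:E) ->
  forall f : T -> \bar R, measurable_fun setT f -> (forall x, 0 <= f x) ->
  \int[nu]_x f x = \int[mu]_x (f x * (g x)%:E).
Proof.
move=> mg g0 nuE f mf f0.
have mgE : measurable_fun setT (EFin \o g) by exact/measurable_EFinP.
have gE0 x : 0 <= (EFin \o g) x by rewrite lee_fin.
pose h := nnsfun_approx measurableT mf.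
have fE x : f x = limn (fun n => (h n x)%:E).
  by apply/esym/cvg_lim => //; apply: cvg_nnsfun_approx.
transitivity (limn (fun n => \int[nu]_x (h n x)%:E)).
  under eq_integral do rewrite fE.
  apply: monotone_convergence => //.
  - by move=> n; apply/measurable_EFinP.
  - by move=> n x _; rewrite lee_fin.
  - by move=> x _ a b ab; rewrite lee_fin; exact/lefP/nd_nnsfun_approx.
transitivity (limn (fun n => \int[mu]_x ((h n x)%:E * (g x)%:E))); last first.
  have fgE x : f x * (g x)%:E = limn (fun n => (h n x)%:E * (g x)%:E).
    apply/esym/cvg_lim => //; apply: cvgeZr => //.
    by apply: cvg_nnsfun_approx.
  under [RHS]eq_integral do rewrite fgE.
  apply/esym; apply: monotone_convergence => //.
  - by move=> n; apply: emeasurable_funM => //; apply/measurable_EFinP.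
  - by move=> n x _; rewrite mule_ge0// lee_fin.
  - move=> x _ a b ab; rewrite lee_wpmul2r ?lee_fin//.
    exact/lefP/nd_nnsfun_approx.
congr (limn _); apply/funext => n.
pose s := h n; rewrite -/s.
have indic_ge0 r x : 0 <= (r * \1_(s @^-1` [set r]) x)%:E.
  exact: nnfun_muleindic_ge0.
have mindic r : measurable_fun setT (fun x => (r * \1_(s @^-1` [set r]) x)%:E).
  by apply/measurable_EFinP; apply: measurable_funM.
under eq_integral do rewrite fimfunE -fsumEFin//.
rewrite ge0_integral_fsum//.
transitivity (\int[mu]_x (\sum_(r \in range s)
    ((r * \1_(s @^-1` [set r]) x)%:E * (g x)%:E))); last first.
  apply: eq_integral => x _; rewrite -ge0_mule_fsuml//.
  by rewrite fsumEFin// -fimfunE.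
rewrite ge0_integral_fsum//; last 2 first.
- by move=> r; apply: emeasurable_funM.
- move=> r x _; apply: mule_ge0; [exact: indic_ge0|exact: gE0].
apply: eq_fsbigr => r rs.
have r0 : (0 <= r)%R by move: rs; rewrite inE => -[x _ <-].
have ms : measurable (s @^-1` [set r]) by exact: measurable_sfunP.
under eq_integral do rewrite EFinM.
under [RHS]eq_integral do rewrite EFinM -muleA.
rewrite ge0_integralZl//; last first.
  by apply/measurable_EFinP/measurable_indic.
rewrite integral_indic// setIT nuE// integral_mkcond.
rewrite ge0_integralZl//.
- congr (_ * _); apply: eq_integral => x _.
  by rewrite epatch_indic muleC.
- apply: emeasurable_funM => //.
  by apply/measurable_EFinP/measurable_indic.
- by move=> x _; rewrite mule_ge0// lee_fin.
Qed.

End density.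

Section real_calculus.
Context {R : realType}.
Local Notation mu := (@lebesgue_measure R).
Implicit Types F f S s : R -> R.

Lemma is_derive_continuous F f : (forall x : R, is_derive x 1 F (f x)) ->
  continuous F.
Proof.
move=> dF x; apply: differentiable_continuous; apply/derivable1_diffP.
by case: (dF x).
Qed.

Lemma is_derive_gt0_incr F f : (forall x : R, is_derive x 1 F (f x)) ->
  (forall x, 0 < f x) -> {mono F : x y / x < y}.
Proof.
move=> dF f0; apply/leW_mono/le_mono => x y xy; rewrite -subr_gt0.
have [c _ ->] : exists2 c, c \in `]x, y[ & F y - F x = f c * (y - x).
  apply: MVT => //.
  exact/continuous_subspaceT/(is_derive_continuous dF).
by rewrite mulr_gt0// subr_gt0.
Qed.

Lemma integral_derive F f a b : (forall x : R, is_derive x 1 F (f x)) ->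
  continuous f -> a <= b ->
  (\int[mu]_(x in `[a, b]) (f x)%:E = (F b - F a)%:E)%E.
Proof.
move=> dF cf; rewrite le_eqVlt => /predU1P[<-|ab].
  by rewrite set_itv1 integral_set1 subrr.
have cF := is_derive_continuous dF.
rewrite (@continuous_FTC2 _ f F)//.
- exact: continuous_subspaceT.
- split=> [x _||]; first by case: (dF x).
  + exact/cvg_at_right_filter/cF.
  + exact/cvg_at_left_filter/cF.
- by move=> x _; rewrite derive1E; case: (dF x).
Qed.

End real_calculus.

Section change_of_variable.
Context {R : realType}.
Local Notation mu := (@lebesgue_measure R).
Variables (S s : R -> R).
Hypothesis dS : forall x : R, is_derive x 1 S (s x).
Hypothesis cs : continuous s.
Hypothesis s_gt0 : forall x, 0 < s x.
Hypothesis surjS : forall y, exists x, S x = y.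
Local Open Scope ereal_scope.

Let ms : measurable_fun setT s.
Proof. exact: continuous_measurable_fun. Qed.

Let mS : measurable_fun setT S.
Proof. by apply: continuous_measurable_fun; exact: is_derive_continuous dS. Qed.

Let dens (A : set (measurableTypeR R)) := \int[mu]_(x in A) (s x)%:E.

Let dens0 : dens set0 = 0.
Proof. by rewrite /dens integral_set0. Qed.

Let dens_ge0 A : 0 <= dens A.
Proof. by apply: integral_ge0 => x _; rewrite lee_fin; exact: ltW. Qed.

Let dens_sigma_additive : semi_sigma_additive dens.
Proof.
move=> /= A mA tA mUA.
rewrite /dens ge0_integral_bigcup//.
- by apply: is_cvg_ereal_nneg_natsum_cond => n _ _; exact: dens_ge0.
- by apply/measurable_funTS/measurable_EFinP.
- by move=> x _; rewrite lee_fin; exact: ltW.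
Qed.

Let dens_mixin :=
  isMeasure.Build _ _ _ dens dens0 dens_ge0 dens_sigma_additive.
Let densM : {measure set (measurableTypeR R) -> \bar R} :=
  HB.pack dens dens_mixin.

Let S_mixin := @isMeasurableFun.Build _ _
  (measurableTypeR R) (measurableTypeR R) S mS.
Let SM : {mfun measurableTypeR R >-> measurableTypeR R} := HB.pack S S_mixin.

Let pushforward_dens A : measurable A -> mu A = pushforward densM SM A.
Proof.
have monoS := is_derive_gt0_incr dS s_gt0.
move=> mA; apply/lebesgue_measure_unique => //= _ [[a b] _ <-].
have [ab|ba] := leP a b; last first.
  by rewrite set_itv_ge ?measure0// bnd_simp -leNgt ltW.
have [[x Sx] [y Sy]] := (surjS a, surjS b).
have xy : (x <= y)%R by rewrite leNgt -monoS Sx Sy -leNgt.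
have -> : pushforward densM SM `]a, b] = dens `]x, y].
  congr dens; apply/seteqP; split => z /=; rewrite !in_itv/= -Sx -Sy.
    by rewrite monoS !leNgt monoS.
  by rewrite monoS !leNgt monoS.
rewrite /dens integral_itv_obnd_cbnd; last first.
  by apply/measurable_funTS/measurable_EFinP.
rewrite (integral_derive dS cs xy) Sx Sy lebesgue_measure_itv/= lte_fin.
by case: ltgtP ab => // ->; rewrite subrr.
Qed.

(** The image under [S] of the measure with density [S'] gives an interval its
    length, by the fundamental theorem of calculus, hence is Lebesgue measure;
    this covers integrands [f] that are merely measurable. *)
Lemma ge0_integral_change_of_variable (f : R -> \bar R) :
  measurable_fun setT f -> (forall x, 0 <= f x) ->
  \int[mu]_y f y = \int[mu]_x (f (S x) * (s x)%:E).
Proof.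
move=> mf f0.
have s_ge0 x : (0 <= s x)%R by exact: ltW.
have mfS : measurable_fun setT (f \o S) by exact: measurableT_comp.
rewrite -(@ge0_integral_density _ _ _ mu densM s ms s_ge0 _ (f \o S) mfS)//; last first.
  by move=> x; exact: f0.
transitivity (\int[pushforward densM SM]_y f y).
  by apply: eq_measure_integral => A mA _; exact: pushforward_dens.
by rewrite ge0_integral_pushforward.
Qed.

End change_of_variable.

(** * Cumulative distribution of a positive continuous density *)

Section cumulative.
Context {R : realType}.
Local Notation mu := (@lebesgue_measure R).
Variable b : R -> R.
Hypothesis cb : continuous b.
Hypothesis b_gt0 : forall x, 0 < b x.
Hypothesis ib : mu.-integrable setT (EFin \o b).

Definition cumul (x : R) : R := \int[mu]_(t in `]-oo, x]) b t.

Let mass : R := \int[mu]_t b t.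

Let mb (A : set R) : measurable A -> measurable_fun A (EFin \o b).
Proof.
move=> mA; apply/measurable_funTS/measurable_EFinP.
exact: continuous_measurable_fun.
Qed.

Let bE_ge0 x : (0 <= (EFin \o b) x)%E.
Proof. by rewrite lee_fin; exact: ltW. Qed.

Let ibS (A : set R) : measurable A -> mu.-integrable A (EFin \o b).
Proof. by move=> mA; apply: integrableS ib. Qed.

Lemma cumul_is_derive (x : R) : is_derive x 1 cumul (b x).
Proof.
have [||||D1 D2] := @continuous_FTC1 R b -oo%O x (x + 1).
- by rewrite ltrDl ltr01.
- exact: ibS.
- exact: ltNyr.
- exact: cb.
by split=> //; rewrite -derive1E.
Qed.

Lemma cumul_mono : {mono cumul : x y / x < y}.
Proof. exact: is_derive_gt0_incr cumul_is_derive b_gt0. Qed.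

Lemma cumul_compl x : \int[mu]_(t in `]x, +oo[) b t = mass - cumul x.
Proof.
have UT : [set: R] = [set` `]-oo, x]] `|` [set` `]x, +oo[].
  by rewrite -setCitvl setUv.
rewrite /mass UT Rintegral_setU -/(cumul x)//; first by rewrite addrAC subrr add0r.
- by rewrite -UT.
- by rewrite -setCitvl; apply/disj_setPCl.
Qed.

(* Both tails are handled by exhausting the line by half-lines. *)
Let mass_approx (F : (set R)^nat) v : nondecreasing_seq F ->
  (forall n, measurable (F n)) -> \bigcup_n F n = setT -> v < mass ->
  exists n, v < \int[mu]_(t in F n) b t.
Proof.
move=> ndF mF FT vm; apply: contrapT => /forallNP nv.
have fE (A : set R) : measurable A ->
    (\int[mu]_(t in A) (EFin \o b) t = (\int[mu]_(t in A) b t)%:E)%E.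
  by move=> mA; rewrite /Rintegral fineK//; apply: integrable_fin_num => //;
    exact: ibS.
have := @ge0_nondecreasing_set_cvg_integral _ (measurableTypeR R) R F
  (EFin \o b) mu ndF mF (fun n => mb (mF n)) (fun _ x _ => bE_ge0 x).
rewrite FT fE// => cvgF.
suff : (mass%:E <= v%:E)%E by rewrite lee_fin leNgt vm.
apply: cvge_le cvgF; apply: nearW => n; have -> := fE _ (mF n).
by rewrite lee_fin leNgt; exact/negP/nv.
Qed.

Lemma cumul_surj v : 0 < v -> v < mass -> exists x, cumul x = v.
Proof.
move=> v0 vm.
have [n vn] : exists n, v < \int[mu]_(t in `]-oo, n%:R]) b t.
  apply: (@mass_approx (fun n => `]-oo, n%:R]%classic)) => //.
  - apply/nondecreasing_seqP => n; rewrite subsetEset.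
    by apply: subset_itvl; rewrite bnd_simp ler_nat.
  - rewrite -subTset => x _; exists (Num.bound x) => //=.
    by rewrite in_itv/= ltW// unstable.ltr_bound.
have [k vk] : exists k, mass - v < \int[mu]_(t in `](- k%:R), +oo[) b t.
  apply: (@mass_approx (fun n => `](- n%:R), +oo[%classic)) => //.
  - apply/nondecreasing_seqP => k; rewrite subsetEset.
    by apply: subset_itvr; rewrite bnd_simp lerN2 ler_nat.
  - rewrite -subTset => x _; exists (Num.bound x) => //=.
    by rewrite in_itv/= andbT ltrNl unstable.ltrNbound.
  - by rewrite ltrBlDr ltrDl.
move: vk; rewrite cumul_compl ltrD2l ltrN2 => vk.
have [|||c _ cE] := @IVT R cumul (- k%:R) n%:R v.
- by rewrite ltW// -cumul_mono (lt_trans vk).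
- exact/continuous_subspaceT/(is_derive_continuous cumul_is_derive).
- by rewrite ge_min le_max (ltW vk) (ltW vn) orbT.
by exists c.
Qed.

Lemma cumul_bounds x : 0 < cumul x < mass.
Proof.
have ge0 y : 0 <= cumul y by apply: Rintegral_ge0 => z _; exact: ltW.
have lem y : cumul y <= mass.
  rewrite -subr_ge0 -cumul_compl; apply: Rintegral_ge0 => z _; exact: ltW.
apply/andP; split.
- by apply: le_lt_trans (ge0 (x - 1)) _; rewrite cumul_mono ltrBlDr ltrDl.
- by apply: lt_le_trans (lem (x + 1)); rewrite cumul_mono ltrDl.
Qed.

End cumulative.

(** * Monotone transport between two densities on the line *)

Section transport.
Context {R : realType}.
Local Notation mu := (@lebesgue_measure R).
Variables (a b : R -> R).
Hypotheses (ca : continuous a) (cb : continuous b).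
Hypotheses (a_gt0 : forall x, 0 < a x) (b_gt0 : forall x, 0 < b x).
Hypotheses (ia : mu.-integrable setT (EFin \o a))
           (ib : mu.-integrable setT (EFin \o b)).
Hypothesis ab : \int[mu]_t a t = \int[mu]_t b t.

(** [T] maps each point to the point of the same quantile, that is,
    [T] is the inverse of [cumul b] composed with [cumul a]. *)
Lemma monotone_transport : exists T : R -> R,
  (forall x, cumul b (T x) = cumul a x) /\
  (forall x : R, is_derive x 1 T (a x / b (T x))).
Proof.
have /choice[T TE] x : exists y, cumul b y = cumul a x.
  by apply: cumul_surj => //;
  have /andP[] := cumul_bounds ca a_gt0 ia x; rewrite // ab.
exists T; split=> // x.
have inj_b : injective (cumul b).
  by apply: inc_inj => y z; rewrite !leNgt cumul_mono.
pose g v := xget 0 [set y | cumul b y = v].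
have gK y : g (cumul b y) = y.
  by apply: inj_b; apply: (@xgetPex _ 0 [set z | cumul b z = cumul b y]); exists y.
have -> : T = g \o cumul a by apply/funext => z /=; rewrite -TE gK.
rewrite /= -TE gK mulrC.
have dgb : is_derive (cumul a x) 1 g (b (T x))^-1.
  rewrite -TE; apply: is_derive_inverse.
  - by near=> z; exact: gK.
  - near=> y; apply: is_derive_continuous (cumul_is_derive cb ib) y.
  - exact: cumul_is_derive.
  - by rewrite gt_eqF.
have dca := cumul_is_derive ca ia x.
exact: is_derive1_comp.
Unshelve. all: by end_near. Qed.

Section interpolation.
Variable T : R -> R.
Hypothesis dT : forall x : R, is_derive x 1 T (a x / b (T x)).
Variable l : R.
Hypothesis l01 : 0 < l < 1.

Let l0 : 0 < l. Proof. by case/andP: l01. Qed.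
Let l1 : 0 < 1 - l. Proof. by rewrite subr_gt0; case/andP: l01. Qed.

Let S (x : R) : R := (1 - l) * x + l * T x.
Let s (x : R) : R := (1 - l) + l * (a x / b (T x)).

Let dS (x : R) : is_derive x 1 S (s x).
Proof.
rewrite /S /s; have dTx := dT x.
by apply: is_derive_eq; rewrite /GRing.scale/= mulr1.
Qed.

Let cT : continuous T. Proof. exact: is_derive_continuous dT. Qed.

Let T' (x : R) : R := a x / b (T x).

Let cT' : continuous T'.
Proof.
move=> x; apply: cvgM; first exact: ca.
apply: cvgV; first by rewrite gt_eqF.
by apply: continuous_comp; [exact: cT|exact: cb].
Qed.

Let cs : continuous s.
Proof.
move=> x; apply: cvgD; first exact: cvg_cst.
by apply: cvgM; [exact: cvg_cst|exact: cT'].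
Qed.

Let s_gt0 x : 0 < s x.
Proof. by rewrite addr_gt0// mulr_gt0// divr_gt0. Qed.

Let T_ndecr : {homo T : x y / x <= y}.
Proof.
have T'_gt0 x : 0 < T' x by exact: divr_gt0.
by move=> x y xy; rewrite leNgt (is_derive_gt0_incr dT T'_gt0) -leNgt.
Qed.

(* As T is nondecreasing, the term (1 - l) * x alone makes S unbounded on both
   sides, so nothing has to be known about the range of T. *)
Let surjS y : exists x, S x = y.
Proof.
pose z := (y - l * T 0) / (1 - l).
have Sz : y = (1 - l) * z + l * T 0.
  by rewrite /z mulrC divfK ?gt_eqF// subrK.
have cS := is_derive_continuous dS.
have [z0|z0] := leP 0 z.
- have S0y : S 0 <= y by rewrite Sz /S mulr0 add0r lerDr mulr_ge0// ltW.
  have ySz : y <= S z by rewrite Sz /S lerD2l ler_pM2l// T_ndecr.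
  have [|||x _ xE] := @IVT R S 0 z y; [by []|exact: continuous_subspaceT| |by exists x].
  by rewrite ge_min le_max S0y ySz orbT.
- have Szy : S z <= y by rewrite Sz /S lerD2l ler_pM2l// T_ndecr// ltW.
  have yS0 : y <= S 0 by rewrite Sz /S mulr0 add0r gerDr pmulr_rle0// ltW.
  have [|||x _ xE] := @IVT R S z 0 y; [exact: ltW|exact: continuous_subspaceT| |by exists x].
  by rewrite ge_min le_max Szy yS0 orbT.
Qed.

Lemma ge0_integral_interpolation (f : R -> \bar R) :
  measurable_fun setT f -> (forall x, (0 <= f x)%E) ->
  (\int[mu]_y f y = \int[mu]_x (f ((1 - l) * x + l * T x)%R
     * ((1 - l) + l * (a x / b (T x)))%:E))%E.
Proof. exact: ge0_integral_change_of_variable dS cs s_gt0 surjS f. Qed.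

Lemma measurable_interpolation (f : R -> \bar R) : measurable_fun setT f ->
  measurable_fun setT (fun x => f ((1 - l) * x + l * T x)%R
     * ((1 - l) + l * (a x / b (T x)))%:E)%E.
Proof.
move=> mf; apply: emeasurable_funM.
  apply: measurableT_comp => //.
  by apply: continuous_measurable_fun; exact: is_derive_continuous dS.
by apply/measurable_EFinP; apply: continuous_measurable_fun; exact: cs.
Qed.

End interpolation.

End transport.

(** * Log-concave functions *)

Section log_concave.
Context {R : realType}.

(** Only applied to positive functions, for which the logarithmic form spares
    the extended values of [ln]. *)
Definition log_concave (E : lmodType R) (g : E -> R) :=
  forall x y l, 0 < l < 1 ->
  (1 - l) * ln (g x) + l * ln (g y) <= ln (g ((1 - l) *: x + l *: y)).

Let concave (c : R -> R) := forall x y l, 0 < l < 1 ->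
  (1 - l) * c x + l * c y <= c ((1 - l) * x + l * y).

(* The slope of the chord over [x, x + h] lies between those of the chords over
   [x, x + 1] and [x - 1, x]. *)
Let concave_lip (c : R -> R) x h : concave c -> 0 < h < 1 ->
  h * (c (x + 1) - c x) <= c (x + h) - c x <= h * (c x - c (x - 1)).
Proof.
move=> cc /andP[h0 h1].
have := cc x (x + 1) h; rewrite h0 h1 => /(_ isT).
have -> : (1 - h) * x + h * (x + 1) = x + h by ring.
have h1' : 0 < 1 + h by rewrite addr_gt0.
have := cc (x + h) (x - 1) (h / (1 + h)).
rewrite divr_gt0// ltr_pdivrMr// mul1r ltrDr ltr01 => /(_ isT).
have -> : (1 - h / (1 + h)) * (x + h) + h / (1 + h) * (x - 1) = x.
  by field; rewrite gt_eqF.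
have -> : (1 - h / (1 + h)) * c (x + h) + h / (1 + h) * c (x - 1) =
    (c (x + h) + h * c (x - 1)) / (1 + h).
  by field; rewrite gt_eqF.
rewrite ler_pdivrMr// => H1 H2.
by apply/andP; split; lra.
Qed.

Let concave_continuous (c : R -> R) : concave c -> continuous c.
Proof.
move=> cc x.
pose K := 1 + `|c (x + 1) - c x| + `|c x - c (x - 1)|.
have K0 : 0 < K by rewrite ltr_wpDr// ltr_wpDr.
have lip h : `|h| < 1 -> `|c (x + h) - c x| <= `|h| * K.
  move=> h1; have [h0|h0|<-] := ltgtP 0 h; last by rewrite addr0 subrr !normr0 mul0r.
  - rewrite (gtr0_norm h0) in h1 *.
    have /andP[H1 H2] : h * (c (x + 1) - c x) <= c (x + h) - c x <= h * (c x - c (x - 1)).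
      by apply: concave_lip; rewrite // h0.
    rewrite ler_norml; apply/andP; split.
      apply: le_trans H1; rewrite -mulrN ler_pM2l//.
      apply: (@le_trans _ _ (- `|c (x + 1) - c x|)).
        by rewrite lerN2 /K -addrA addrCA lerDl addr_ge0.
      by rewrite lerNl -normrN ler_norm.
    apply: (le_trans H2); rewrite ler_pM2l// /K.
    by apply: (le_trans (ler_norm _)); rewrite lerDr addr_ge0.
  - rewrite (ltr0_norm h0) in h1 *.
    pose c' y := c (- y).
    have cc' : concave c'.
      move=> y z l l01; rewrite /c' opprD -!mulrN; exact: cc.
    have /andP[] : - h * (c' (- x + 1) - c' (- x)) <= c' (- x + - h) - c' (- x) <=
        - h * (c' (- x) - c' (- x - 1)).
      by apply: concave_lip; rewrite // oppr_gt0 h0.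
    rewrite /c' !opprD !opprK => H1 H2.
    have h0' : 0 < - h by rewrite oppr_gt0.
    rewrite ler_norml; apply/andP; split.
      apply: le_trans H1; rewrite -mulrN ler_pM2l//.
      apply: (@le_trans _ _ (- `|c x - c (x - 1)|)).
        by rewrite lerN2 /K lerDr addr_ge0.
      by rewrite lerNl opprB ler_norm.
    apply: (le_trans H2); rewrite ler_pM2l// /K.
    rewrite -normrN opprB.
    by apply: (le_trans (ler_norm _)); rewrite distrC -addrA addrCA lerDl addr_ge0.
apply/cvgrPdist_lt => e e0; near=> y.
have -> : y = x + (y - x) by rewrite addrC subrK.
have yx : `|y - x| < Num.min 1 (e / K).
  near: y; apply/nbhs_ballP; exists (Num.min 1 (e / K)) => /=.
    by rewrite lt_min ltr01 divr_gt0.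
  by move=> y; rewrite /ball/= distrC.
move: yx; rewrite lt_min => /andP[y1 ye].
rewrite distrC; apply: (le_lt_trans (lip _ y1)).
by rewrite -ltr_pdivlMr.
Unshelve. all: by end_near. Qed.

Lemma log_concave_continuous (g : R -> R) : (forall x, 0 < g x) ->
  @log_concave R^o g -> continuous g.
Proof.
move=> g0 lg.
have -> : g = expR \o (@ln R \o g) by apply/funext => x /=; rewrite lnK// posrE.
have cln : continuous (@ln R \o g) by apply: concave_continuous => x y l; exact: lg.
by move=> x; apply: continuous_comp; [exact: cln|exact: continuous_expR].
Qed.

End log_concave.

(** * Prekopa inequality on the line *)

Section prekopa_line.
Context {R : realType}.
Local Notation mu := (@lebesgue_measure R).

Lemma Rintegral_gt0 (u : R -> R) : continuous u -> (forall x, 0 < u x) ->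
  mu.-integrable setT (EFin \o u) -> 0 < \int[mu]_x u x.
Proof.
move=> cu u0 iu; have /andP[a b] := cumul_bounds cu u0 iu 0.
exact: lt_trans a b.
Qed.

(** Concavity of the logarithm between [1] and [z]. *)
Lemma ln_mix (l z : R) : 0 < l < 1 -> 0 < z -> l * ln z <= ln (1 - l + l * z).
Proof.
move=> /andP[l0 l1] z0.
have l01 : 0 <= l <= 1 by rewrite !ltW.
have := @concave_ln R (Itv01 (ltW l0) (ltW l1)) z 1 z0 ltr01.
by rewrite !convRE /= ln1 mulr0 addr0 mulr1 /unstable.onem addrC.
Qed.

(** Let [T] transport [u] to [v] rescaled to the same mass, and substitute
    [S x = (1 - l) x + l (T x)] in the integral of [w]: the weight
    [S' = 1 - l + l T'] is at least [T' ^ l], and [T'] is the quotient of the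
    normalized densities, which turns the hypothesis at [(x, T x)] into a bound
    of [w (S x) S' x] by a constant multiple of [u x]. *)
Lemma prekopa_line (u v w : R -> R) (l : R) : 0 < l < 1 ->
  continuous u -> continuous v -> measurable_fun setT w ->
  (forall x, 0 < u x) -> (forall x, 0 < v x) -> (forall x, 0 < w x) ->
  mu.-integrable setT (EFin \o u) -> mu.-integrable setT (EFin \o v) ->
  mu.-integrable setT (EFin \o w) ->
  (forall x y, (1 - l) * ln (u x) + l * ln (v y) <= ln (w ((1 - l) * x + l * y))) ->
  (1 - l) * ln (\int[mu]_x u x) + l * ln (\int[mu]_x v x) <= ln (\int[mu]_x w x).
Proof.
move=> l01 cu cv mw u0 v0 w0 iu iv iw uvw.
have [l0 l1] := andP l01.
set U := \int[mu]_x u x; set V := \int[mu]_x v x; set W := \int[mu]_x w x.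
have U0 : 0 < U by exact: Rintegral_gt0.
have V0 : 0 < V by exact: Rintegral_gt0.
(* v rescaled to the mass of u. *)
pose b x := U / V * v x.
have UV0 : 0 < U / V by exact: divr_gt0.
have b0 x : 0 < b x by exact: mulr_gt0.
have cb : continuous b.
  by move=> x; apply: cvgM; [exact: cvg_cst|exact: cv].
have ib : mu.-integrable setT (EFin \o b).
  rewrite (_ : _ \o _ = (fun x => (U / V)%:E * (EFin \o v) x)%E)//.
  exact: integrableZl.
have Ub : U = \int[mu]_x b x by rewrite RintegralZl// -/V divfK// gt_eqF.
have [T [_ dT]] := monotone_transport cu cb u0 b0 iu ib Ub.
pose C := expR (l * (ln V - ln U)).
suff UCW : U * C <= W.
  have W0 : 0 < W by apply: lt_le_trans UCW; rewrite mulr_gt0// expR_gt0.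
  rewrite -ler_ln ?posrE ?mulr_gt0 ?expR_gt0// in UCW.
  apply: le_trans UCW; rewrite lnM ?posrE ?expR_gt0// expRK.
  by rewrite le_eqVlt; apply/orP; left; apply/eqP; ring.
rewrite -lee_fin /U /W EFinM /Rintegral !fineK; last 2 first.
- exact: integrable_fin_num.
- exact: integrable_fin_num.
rewrite [leRHS](@ge0_integral_interpolation R u b cu cb u0 b0 T dT l l01 (EFin \o w)); last 2 first.
- exact/measurable_EFinP.
- by move=> x; rewrite lee_fin ltW.
rewrite muleC -ge0_integralZl//; last 3 first.
- by apply/measurable_EFinP; exact: continuous_measurable_fun.
- by move=> x _; rewrite lee_fin ltW.
- by rewrite lee_fin expR_ge0.
apply: ge0_le_integral => //.
- by move=> x _; rewrite lee_fin mulr_ge0 ?expR_ge0// ltW.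
- apply/measurable_EFinP/measurable_funM => //.
  exact: continuous_measurable_fun.
- by apply: measurable_interpolation => //; apply/measurable_EFinP.
move=> x _ /=; rewrite -!EFinM lee_fin.
set T' := u x / b (T x).
have T'0 : 0 < T' by exact: divr_gt0.
have s0 : 0 < 1 - l + l * T' by rewrite addr_gt0 ?subr_gt0// mulr_gt0.
rewrite -ler_ln ?posrE ?mulr_gt0 ?expR_gt0//.
rewrite !lnM ?posrE ?expR_gt0// expRK.
have := lerD (uvw x (T x)) (ln_mix l01 T'0).
apply: le_trans.
rewrite /T' /b !ln_div ?lnM ?posrE ?mulr_gt0 ?invr_gt0//.
by rewrite lnV ?posrE// le_eqVlt; apply/orP; left; apply/eqP; ring.
Qed.

End prekopa_line.

(** * The Gaussian line *)

Section tail_comparison.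
Context {R : realType}.
Local Notation mu := (@lebesgue_measure R).
Variables (a b : R -> R).
Hypotheses (ca : continuous a) (cb : continuous b).
Hypotheses (a_gt0 : forall x, 0 < a x) (b_gt0 : forall x, 0 < b x).
Hypotheses (ia : mu.-integrable setT (EFin \o a))
           (ib : mu.-integrable setT (EFin \o b)).

Let ma : measurable_fun setT a. Proof. exact: continuous_measurable_fun. Qed.
Let mb : measurable_fun setT b. Proof. exact: continuous_measurable_fun. Qed.

Lemma Rintegral_shift_le (A B : set R) (d c : R) :
  measurable A -> measurable B -> (forall x, A x <-> B (x + d)) ->
  (forall x, A x -> b (x + d) <= c * a x) ->
  \int[mu]_(x in B) b x <= c * \int[mu]_(x in A) a x.
Proof.
move=> mA mB AB bca.
have iaA : mu.-integrable A (EFin \o a) by exact: integrableS ia.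
have ibB : mu.-integrable B (EFin \o b) by exact: integrableS ib.
rewrite -RintegralZl// -lee_fin /Rintegral !fineK; last 2 first.
- apply: integrable_fin_num => //.
  rewrite (_ : (fun x => (c * a x)%:E) = (fun x => c%:E * (EFin \o a) x)%E)//.
  exact: integrableZl.
- exact: integrable_fin_num.
rewrite integral_mkcond [leRHS]integral_mkcond.
have dS (x : R) : is_derive x 1 (fun z : R => z + d) ((fun=> 1) x).
  by apply: is_derive_eq; rewrite addr0.
have mrB : measurable_fun setT ((EFin \o b) \_ B).
  by apply/(measurable_restrictT _ mB); exact/measurable_funTS/measurable_EFinP.
have mrA : measurable_fun setT ((EFin \o (fun x => c * a x)) \_ A).
  apply/(measurable_restrictT _ mA); apply/measurable_funTS/measurable_EFinP.
  exact: measurable_funM.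
have rB0 x : (0 <= ((EFin \o b) \_ B) x)%E.
  by apply: erestrict_ge0 => z _; rewrite lee_fin ltW.
rewrite (ge0_integral_change_of_variable dS _ _ _ mrB rB0)//; last 2 first.
- by move=> x; exact: cvg_cst.
- by move=> y; exists (y - d); rewrite subrK.
apply: ge0_le_integral => //.
- by move=> x _; rewrite mule1.
- apply: emeasurable_funM => //; apply: measurableT_comp => //.
  exact: measurable_funD.
move=> x _; rewrite mule1.
rewrite !patchE; have [Ax|Ax] := boolP (x \in A).
  rewrite mem_set; last by apply/AB; move: Ax; rewrite inE.
  by rewrite lee_fin; apply: bca; move: Ax; rewrite inE.
rewrite memNset//; move/AB; move: Ax; rewrite notin_setE; exact.
Qed.

(** If [b y0 < a x0], the hypothesis bounds [b] on one side of [y0] by a multiple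
    less than one of the translate of [a], although the two tails on that side
    have equal mass. *)
Lemma tail_comparison x0 y0 : \int[mu]_x a x = \int[mu]_x b x ->
  cumul b y0 = cumul a x0 ->
  (forall t, 0 < t -> b (y0 + t) <= b y0 / a x0 * a (x0 + t)) \/
  (forall t, t <= 0 -> b (y0 + t) <= b y0 / a x0 * a (x0 + t)) ->
  a x0 <= b y0.
Proof.
move=> ab Fab H; rewrite leNgt; apply/negP => ba.
have c1 : b y0 / a x0 < 1 by rewrite ltr_pdivrMr// mul1r.
have /andP[F0 Fm] := cumul_bounds ca a_gt0 ia x0.
have shift x : x + (y0 - x0) = y0 + (x - x0) by rewrite addrCA.
case: H => H.
- have : \int[mu]_(x in `]y0, +oo[) b x <=
      b y0 / a x0 * \int[mu]_(x in `]x0, +oo[) a x.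
    apply: (@Rintegral_shift_le _ _ (y0 - x0)) => //.
      by move=> x; rewrite /= !in_itv/= !andbT shift ltrDl subr_gt0.
    move=> x; rewrite /= in_itv/= andbT => xx0; rewrite shift.
    by have := H (x - x0); rewrite subr_gt0 => /(_ xx0); rewrite [x0 + _]addrC subrK.
  rewrite !cumul_compl// Fab -ab leNgt => /negP; apply.
  by rewrite gtr_pMl// subr_gt0.
- have : cumul b y0 <= b y0 / a x0 * cumul a x0.
    apply: (@Rintegral_shift_le _ _ (y0 - x0)) => //.
      by move=> x; rewrite /= !in_itv/= shift gerDl subr_le0.
    move=> x; rewrite /= in_itv/= => xx0; rewrite shift.
    by have := H (x - x0); rewrite subr_le0 => /(_ xx0); rewrite [x0 + _]addrC subrK.
  by rewrite Fab leNgt => /negP; apply; rewrite gtr_pMl.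
Qed.

End tail_comparison.

Section gauss_pdf.
Context {R : realType}.
Local Notation mu := (@lebesgue_measure R).
Local Notation phi := (@normal_pdf R 0 1).

Lemma gauss_pdfE x : phi x = normal_peak 1 * expR (- (x ^+ 2 / 2)).
Proof.
rewrite normal_pdfE ?oner_eq0// /normal_fun subr0 expr1n mulNr.
by congr (_ * expR (- (_ / _))).
Qed.

Let peak_gt0 : 0 < @normal_peak R 1. Proof. by rewrite normal_peak_gt0// oner_eq0. Qed.

Lemma gauss_pdf_gt0 x : 0 < phi x.
Proof. by rewrite gauss_pdfE mulr_gt0// expR_gt0. Qed.

Lemma ln_gauss_pdf x : ln (phi x) = ln (normal_peak 1) - x ^+ 2 / 2.
Proof. by rewrite gauss_pdfE lnM ?posrE ?expR_gt0// expRK. Qed.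

Lemma gauss_pdf_continuous : continuous phi.
Proof. by apply: continuous_normal_pdf; rewrite oner_eq0. Qed.

Lemma gauss_pdf_integrable : mu.-integrable setT (EFin \o phi).
Proof. exact: integrable_normal_pdf. Qed.

Lemma gauss_pdf_mass : \int[mu]_x phi x = 1.
Proof. by rewrite /Rintegral integral_normal_pdf. Qed.

Lemma gauss_pdf_is_derive (x : R) : is_derive x 1 phi (- x * phi x).
Proof.
have -> : phi = fun x => normal_peak 1 * expR (- (x ^+ 2 / 2)).
  by apply/funext => y; exact: gauss_pdfE.
apply: is_derive_eq; rewrite /GRing.scale/= !mulr1 !mulr0 ?addr0.
by field.
Qed.

(** Makes [x * phi x] vanish at infinity at an explicit rate. *)
Lemma sqr_gauss_pdf_le x : x ^+ 2 * phi x <= 2 * normal_peak 1.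
Proof.
rewrite gauss_pdfE mulrCA mulrC ler_pM2r// expRN ler_pdivrMr ?expR_gt0//.
by have := expR_ge1Dx (x ^+ 2 / 2); lra.
Qed.

Lemma ge0_integral_gauss (f : R -> \bar R) : measurable_fun setT f ->
  (forall x, (0 <= f x)%E) ->
  (\int[normal_prob 0 1]_x f x = \int[mu]_x (f x * (phi x)%:E))%E.
Proof.
move=> mf f0; apply: (@ge0_integral_density _ _ _ mu (normal_prob 0 1) phi) => //.
- exact: measurable_normal_pdf.
- by move=> x; rewrite ltW// gauss_pdf_gt0.
Qed.

(** Caffarelli's contraction on the line: by [monotone_transport], the conclusion
    says that the transport of [phi] to [K q phi] has slope at most one. The
    logarithm of the quotient of the two densities, translated to [y0] and [x0],
    is concave in the displacement because the quadratic terms cancel;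
    vanishing at [0] up to the normalization, it is nonpositive on one side of
    [0], and [tail_comparison] applies. *)
Lemma gauss_contraction (q : R -> R) (K x0 y0 : R) : 0 < K ->
  (forall x, 0 < q x) -> @log_concave R R^o q ->
  mu.-integrable setT (EFin \o (fun x => K * (q x * phi x))) ->
  \int[mu]_x (K * (q x * phi x)) = 1 ->
  cumul (fun x => K * (q x * phi x)) y0 = cumul phi x0 ->
  phi x0 <= K * (q y0 * phi y0).
Proof.
move=> K0 q0 lq ib b1 bE.
have cq := log_concave_continuous q0 lq.
have b0 x : 0 < K * (q x * phi x) by rewrite !mulr_gt0// gauss_pdf_gt0.
apply: (@tail_comparison R phi (fun x => K * (q x * phi x))) => //.
- exact: gauss_pdf_continuous.
- move=> x; apply: cvgM; first exact: cvg_cst.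
  by apply: cvgM; [exact: cq|exact: gauss_pdf_continuous].
- exact: gauss_pdf_gt0.
- exact: gauss_pdf_integrable.
- by rewrite b1 gauss_pdf_mass.
(* The normalized log-quotient of the densities at displacement t. *)
pose r t := ln (q (y0 + t)) - ln (q y0) + (x0 - y0) * t.
have rle t : r t <= 0 ->
    K * (q (y0 + t) * phi (y0 + t)) <=
    K * (q y0 * phi y0) / phi x0 * phi (x0 + t).
  move=> rt; rewrite -ler_ln ?posrE; first last.
  - by rewrite ?(divr_gt0, mulr_gt0, gauss_pdf_gt0, q0).
  - by rewrite ?(divr_gt0, mulr_gt0, gauss_pdf_gt0, q0).
  rewrite !lnM ?posrE ?(divr_gt0, invr_gt0, mulr_gt0, gauss_pdf_gt0, q0)//.
  by rewrite lnV ?posrE ?gauss_pdf_gt0// !ln_gauss_pdf; move: rt; rewrite /r; lra.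
have [rpos|/existsNP[s /not_implyP[s0 /negP]]] :=
  pselect (forall t, 0 < t -> r t <= 0).
  by left => t t0; apply: rle; exact: rpos.
rewrite -ltNge => rs; right => t t0; apply: rle; rewrite leNgt; apply/negP => rt.
move: t0; rewrite le_eqVlt => /predU1P[t0|t0].
  by move: rt; rewrite t0 /r addr0 subrr mulr0 addr0 ltxx.
have st : 0 < s - t by rewrite subr_gt0 (lt_trans t0).
pose l := - t / (s - t).
have l01 : 0 < l < 1.
  by rewrite /l divr_gt0 ?oppr_gt0// ltr_pdivrMr// mul1r; lra.
have := lq (y0 + t) (y0 + s) l l01.
have -> : (1 - l) *: (y0 + t : R^o) + l *: (y0 + s : R^o) = y0.
  by rewrite /GRing.scale/= /l; field; rewrite gt_eqF.
have lE : (1 - l) * t + l * s = 0 by rewrite /l; field; rewrite gt_eqF.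
have [l0 l1] := andP l01.
have := addr_gt0 (mulr_gt0 (_ : 0 < 1 - l) rt) (mulr_gt0 l0 rs).
rewrite subr_gt0 => /(_ l1).
have -> : (1 - l) * r t + l * r s =
  (1 - l) * ln (q (y0 + t)) + l * ln (q (y0 + s)) - ln (q y0)
  + (x0 - y0) * ((1 - l) * t + l * s) by rewrite /r; ring.
by rewrite lE; lra.
Qed.

End gauss_pdf.

(** * Integrals of functions with values in ]0, 1] *)

Section unit_valued.
Context d (T : measurableType d) (R : realType) (P : probability T R).
Variable f : T -> R.
Hypotheses (mf : measurable_fun setT f) (f01 : forall x, 0 < f x <= 1).

Let f0 x : 0 < f x. Proof. by case/andP: (f01 x). Qed.
Let f1 x : f x <= 1. Proof. by case/andP: (f01 x). Qed.

Lemma unit_integral_le1 : (\int[P]_x (f x)%:E <= 1)%E.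
Proof.
apply: (@le_trans _ _ (\int[P]_x (cst 1%E x))%E).
  apply: ge0_le_integral => //.
  - by move=> x _; rewrite lee_fin ltW.
  - exact/measurable_EFinP.
  - by move=> x _; rewrite lee_fin.
by rewrite integral_cst// mul1e; exact: probability_le1.
Qed.

Lemma unit_integrable : P.-integrable setT (EFin \o f).
Proof.
apply/integrableP; split; first exact/measurable_EFinP.
under eq_integral do rewrite /= gtr0_norm//.
by apply: le_lt_trans unit_integral_le1 _; rewrite ltry.
Qed.

Lemma unit_RintegralE : ((\int[P]_x f x)%:E = \int[P]_x (f x)%:E)%E.
Proof. by rewrite fineK//; exact: integrable_fin_num unit_integrable. Qed.

Lemma unit_Rintegral01 : 0 < \int[P]_x f x <= 1.
Proof.
rewrite -lee_fin unit_RintegralE unit_integral_le1 andbT.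
rewrite lt_neqAle -lee_fin unit_RintegralE integral_ge0 ?andbT; last first.
  by move=> x _; rewrite lee_fin ltW.
apply/eqP => I0'; have I0 := congr1 EFin I0'; rewrite unit_RintegralE in I0.
have : (\int[P]_x `|(f x)%:E| = 0)%E.
  by under eq_integral do rewrite /= gtr0_norm//.
move/(ae_eq_integral_abs P measurableT (measurable_int _ unit_integrable)) => /= [N [mN N0 fN]].
have : (P setT <= P N)%E.
  apply: le_measure; rewrite ?inE//.
  by move=> x _; apply: fN => /= /(_ I) [/eqP]; rewrite gt_eqF.
by rewrite probability_setT N0 lee_fin ler10.
Qed.

End unit_valued.

(** * The three-function inequality on the Gaussian line *)

Section three_functions_line.
Context {R : realType}.
Local Notation mu := (@lebesgue_measure R).
Local Notation phi := (@normal_pdf R 0 1).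
Local Notation gamma := (@normal_prob R 0 1).

(** The difference of the two sides vanishes at [z = 1] and is nonincreasing on
    [0 < z <= 1], by convexity of the inverse. *)
Lemma ln_interpolation (d z : R) : 0 < d < 1 -> 0 < z <= 1 ->
  (d - d ^+ 2) * (z - 1) <= ln (1 - d + d * z) - d ^+ 2 * ln z.
Proof.
move=> /andP[d0 d1] /andP[z0 z1].
pose F (x : R) := ln (1 - d + d * x) - d ^+ 2 * ln x - (d - d ^+ 2) * (x - 1).
have pos x : 0 < x -> 0 < 1 - d + d * x.
  by move=> x0; rewrite addr_gt0 ?subr_gt0// mulr_gt0.
have dF (x : R) : 0 < x -> is_derive x 1 F
    (d / (1 - d + d * x) - d ^+ 2 / x - (d - d ^+ 2)).
  move=> x0; have px := pos x x0.
  have H1 : is_derive x 1 (fun y : R => 1 - d + d * y) d.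
    by apply: is_derive_eq; rewrite /GRing.scale/=; ring.
  have H2 := is_derive1_ln px; have H3 := @is_derive1_comp _ (@ln R) (fun y : R => 1 - d + d * y) _ _ _ H2 H1.
  have H4 := is_derive1_ln x0.
  rewrite /F; apply: is_derive_eq; rewrite /GRing.scale/=; ring.
suff : F 1 <= F z.
  by rewrite /F mulr1 subrK ln1 mulr0 !subrr mulr0 subr0 subr_ge0.
rewrite -subr_le0.
have [||c /andP[+ c1] ->] := @MVT_segment R F
  (fun x => d / (1 - d + d * x) - d ^+ 2 / x - (d - d ^+ 2)) z 1 z1.
- by move=> x /[!in_itv]/= /andP[zx _]; apply: dF; exact: lt_trans zx.
- apply: derivable_within_continuous => x /[!in_itv]/= /andP[zx _].
  by have [] := dF x (lt_le_trans z0 zx).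
rewrite bnd_simp => zc.
have c0 : 0 < c by exact: lt_le_trans zc.
have pc := pos c c0.
rewrite mulr_le0_ge0 ?subr_ge0//.
have -> : d / (1 - d + d * c) - d ^+ 2 / c - (d - d ^+ 2) =
   - (d * ((d * (1 - d) * (1 - c) ^+ 2) / (c * (1 - d + d * c)))).
  by field; rewrite !gt_eqF.
rewrite oppr_le0; apply: mulr_ge0; [exact: ltW|apply: divr_ge0].
  by apply: mulr_ge0; [rewrite ltW// mulr_gt0// subr_gt0|exact: sqr_ge0].
by rewrite ltW// mulr_gt0.
Qed.

Lemma unit_gauss_integrable (f : R -> R) : measurable_fun setT f ->
  (forall x, 0 < f x <= 1) ->
  mu.-integrable setT (EFin \o (fun x => f x * phi x)).
Proof.
move=> mf f01; apply: le_integrable gauss_pdf_integrable => //.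
  apply/measurable_EFinP/measurable_funM => //.
  exact: measurable_normal_pdf.
move=> x _ /=; have /andP[f0 f1] := f01 x.
by rewrite lee_fin normrM ler_piMl// gtr0_norm.
Qed.

Lemma unit_gauss_Rintegral (f : R -> R) : measurable_fun setT f ->
  (forall x, 0 < f x <= 1) ->
  \int[gamma]_x f x = \int[mu]_x (f x * phi x).
Proof.
move=> mf f01; rewrite /Rintegral ge0_integral_gauss//.
  exact/measurable_EFinP.
by move=> x; have /andP[f0 _] := f01 x; rewrite lee_fin ltW.
Qed.

(** The Gaussian density is log-concave, so it can be absorbed in the three
    functions. *)
Lemma prekopa_gauss_line (u v w : R -> R) (l : R) : 0 < l < 1 ->
  continuous u -> continuous v -> measurable_fun setT w ->
  (forall x, 0 < u x <= 1) -> (forall x, 0 < v x <= 1) ->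
  (forall x, 0 < w x <= 1) ->
  (forall x y, (1 - l) * ln (u x) + l * ln (v y) <= ln (w ((1 - l) * x + l * y))) ->
  (1 - l) * ln (\int[gamma]_x u x) + l * ln (\int[gamma]_x v x) <=
  ln (\int[gamma]_x w x).
Proof.
move=> l01 cu cv mw u01 v01 w01 uvw.
have gt0 (f : R -> R) : (forall x, 0 < f x <= 1) -> forall x, 0 < f x.
  by move=> f01 x; case/andP: (f01 x).
have mu' := continuous_measurable_fun cu.
have mv := continuous_measurable_fun cv.
rewrite !unit_gauss_Rintegral//.
have cphi (f : R -> R) : continuous f -> continuous (fun x => f x * phi x).
  by move=> cf x; apply: cvgM; [exact: cf|exact: gauss_pdf_continuous].
have pphi (f : R -> R) : (forall x, 0 < f x <= 1) -> forall x, 0 < f x * phi x.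
  by move=> f01 x; rewrite mulr_gt0 ?gauss_pdf_gt0//; exact: gt0 f01 x.
apply: prekopa_line => //; try exact: unit_gauss_integrable.
- exact: cphi.
- exact: cphi.
- by apply: measurable_funM => //; exact: measurable_normal_pdf.
- exact: pphi.
- exact: pphi.
- exact: pphi.
move=> x y; rewrite !lnM ?posrE ?gauss_pdf_gt0 ?(gt0 _ u01) ?(gt0 _ v01) ?(gt0 _ w01)//.
rewrite !ln_gauss_pdf; have [l0 l1] := andP l01.
have := uvw x y.
have : 0 <= l * (1 - l) * (x - y) ^+ 2.
  by rewrite mulr_ge0 ?sqr_ge0// mulr_ge0 ?ltW// subr_gt0.
nra.
Qed.

End three_functions_line.

Section three_functions_gauss.
Context {R : realType}.
Local Notation mu := (@lebesgue_measure R).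
Local Notation phi := (@normal_pdf R 0 1).
Local Notation gamma := (@normal_prob R 0 1).

Let phi_gt0 := @gauss_pdf_gt0 R.
Let mphi : measurable_fun setT phi. Proof. exact: measurable_normal_pdf. Qed.

Let itvN (n : nat) := `[- (n%:R : R), n%:R]%classic.

Let gauss_itv_cvg : \int[mu]_(x in itvN n) phi x @[n --> \oo] --> (1 : R).
Proof.
have mphiE A : measurable A -> measurable_fun A (EFin \o phi).
  by move=> mA; apply/measurable_funTS/measurable_EFinP.
have ndI : nondecreasing_seq itvN.
  apply/nondecreasing_seqP => n; rewrite subsetEset /itvN.
  by apply: subset_itv; rewrite bnd_simp ?lerN2 ler_nat.
have mI n : measurable (itvN n) by exact: measurable_itv.
have := @ge0_nondecreasing_set_cvg_integral _ (measurableTypeR R) R itvN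
  (EFin \o phi) mu ndI mI (fun n => mphiE _ (mI n))
  (fun _ x _ => ltW (phi_gt0 x)).
rewrite /itvN (bigcup_itvT true false) integral_normal_pdf.
move/fine_cvg; apply: cvg_trans; apply: near_eq_cvg; near=> n.
by [].
Unshelve. all: by end_near. Qed.

(** With [r x] the integrand obtained by substituting [S] in the integral [I] of
    [p], the inequality [ln (r / I) <= r / I - 1] (Jensen's inequality in
    pointwise form) leaves a bound that can be integrated over bounded intervals
    before passing to the limit, so that no integrability of [ln T'] is needed. *)
Lemma three_functions_line (d : R) (p q : R -> R) (k : R -> \bar R) :
  0 < d < 1 -> measurable_fun setT p -> measurable_fun setT k ->
  (forall x, 0 < p x <= 1) -> (forall x, 0 < q x <= 1) ->
  (forall x, (0 <= k x)%E) -> @log_concave R R^o q ->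
  (forall x y, ((- ln (p ((1 - d) * x + d * y)) + d ^+ 2 * ln (q y))%:E <= k x)%E) ->
  ((- ln (\int[gamma]_x p x) + d ^+ 2 * ln (\int[gamma]_x q x))%:E <=
   \int[gamma]_x k x)%E.
Proof.
move=> d01 mp mk p01 q01 k0 lq pqk; have [d0 d1] := andP d01.
have p_gt0 x : 0 < p x by case/andP: (p01 x).
have q_gt0 x : 0 < q x by case/andP: (q01 x).
have cq := log_concave_continuous q_gt0 lq.
have mq : measurable_fun setT q by exact: continuous_measurable_fun.
have /andP[I0 I1] := unit_Rintegral01 gamma mp p01.
have /andP[Z0 Z1] := unit_Rintegral01 gamma mq q01.
set I := \int[gamma]_x p x in I0 I1 *; set Z := \int[gamma]_x q x in Z0 Z1 *.
pose b x := Z^-1 * (q x * phi x).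
have iqphi := unit_gauss_integrable mq q01.
have ib : mu.-integrable setT (EFin \o b).
  rewrite (_ : _ \o _ = (fun x => Z^-1%:E * (EFin \o (fun x => q x * phi x)%R) x)%E)//.
  exact: integrableZl.
have b1 : \int[mu]_x b x = 1.
  by rewrite RintegralZl// -unit_gauss_Rintegral// -/Z mulVf// gt_eqF.
have b_gt0 x : 0 < b x by rewrite !mulr_gt0// invr_gt0.
have cb : continuous b.
  move=> x; apply: cvgM; first exact: cvg_cst.
  by apply: cvgM; [exact: cq|exact: gauss_pdf_continuous].
have [|T [TE dT]] := monotone_transport (@gauss_pdf_continuous R) cb phi_gt0 b_gt0
  (@gauss_pdf_integrable R) ib.
  by rewrite b1 gauss_pdf_mass.
pose T' x := phi x / b (T x).
have T'_gt0 x : 0 < T' x by exact: divr_gt0.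
have T'_le1 x : T' x <= 1.
  rewrite ler_pdivrMr// mul1r.
  by apply: gauss_contraction => //; rewrite ?invr_gt0.
have [ky|kfin] := eqVneq (\int[gamma]_x k x)%E +oo%E; first by rewrite ky leey.
pose S x := (1 - d) * x + d * T x.
pose c := 1 - ln I + d ^+ 2 * ln Z.
pose J x := T' x - 1 - x * (T x - x).
have s_gt0 x : 0 < 1 - d + d * T' x.
  by rewrite addr_gt0 ?subr_gt0// mulr_gt0.
pose r x := p (S x) * phi (S x) * (1 - d + d * T' x).
have r_gt0 x : 0 < r x by rewrite !mulr_gt0.
(* J collects the terms of the exponent left after ln_interpolation; J * phi is
   the derivative of (T x - x) * phi. *)
have pointwise x : ((c * phi x + (d - d ^+ 2) * (J x * phi x))%:E <=
    k x * (phi x)%:E + (I^-1 * r x)%:E)%E.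
  suff : ((c + (d - d ^+ 2) * J x - I^-1 * r x / phi x)%:E <= k x)%E.
    move=> H; rewrite -leeBlDr// -EFinB.
    have -> : c * phi x + (d - d ^+ 2) * (J x * phi x) - I^-1 * r x =
        (c + (d - d ^+ 2) * J x - I^-1 * r x / phi x) * phi x.
      by field; rewrite !gt_eqF.
    by rewrite EFinM lee_wpmul2r// lee_fin ltW.
  apply: le_trans (pqk x (T x)); rewrite lee_fin.
  pose z := I^-1 * r x / phi x; rewrite -/z.
  have z0 : 0 < z by rewrite /z !(mulr_gt0, divr_gt0, invr_gt0).
  have := @le_ln1Dx R (z - 1).
  rewrite ltrBrDr addNr z0 addrC subrK => /(_ isT).
  rewrite {1}/z /r !lnM ?posrE ?(mulr_gt0, invr_gt0)// !lnV ?posrE// -/(S x).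
  have /andP[_ T'1] : 0 < T' x <= 1 by rewrite T'_gt0 T'_le1.
  have := @ln_interpolation R d (T' x) d01; rewrite T'_gt0 T'1 => /(_ isT).
  have : ln (T' x) = ln (phi x) - (- ln Z + (ln (q (T x)) + ln (phi (T x)))).
    by rewrite /T' /b lnM ?lnV ?posrE ?invr_gt0 ?lnM ?posrE ?(mulr_gt0, invr_gt0)// lnV ?posrE.
  rewrite !ln_gauss_pdf /c /J => -> H1 H2.
  have SE : S x = (1 - d) * x + d * T x by [].
  have E2 : (x ^+ 2 - S x ^+ 2) / 2 - d ^+ 2 * ((x ^+ 2 - T x ^+ 2) / 2) =
     - (d - d ^+ 2) * (x * (T x - x)) by rewrite SE; field.
  lra.
have cphi := @gauss_pdf_continuous R.
have cT : continuous T by exact: is_derive_continuous dT.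
have mr : measurable_fun setT r.
  have cS : continuous S.
    move=> x; apply: cvgD; apply: cvgM; try exact: cvg_cst; first exact: cvg_id.
    exact: cT.
  have mS : measurable_fun setT S by exact: continuous_measurable_fun.
  have mT' : measurable_fun setT T'.
    apply: continuous_measurable_fun => x; apply: cvgM; first exact: cphi.
    apply: cvgV; first by rewrite gt_eqF.
    by apply: continuous_comp; [exact: cT|exact: cb].
  apply: measurable_funM.
    by apply: measurable_funM; exact: measurableT_comp.
  by apply: measurable_funD => //; exact: measurable_funM.
have r_int : (\int[mu]_x (r x)%:E = I%:E)%E.
  rewrite /I unit_RintegralE// ge0_integral_gauss//; last 2 first.
  - exact/measurable_EFinP.
  - by move=> x; rewrite lee_fin ltW.
  rewrite [RHS](ge0_integral_interpolation cphi cb phi_gt0 b_gt0 dT d01)//.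
  - exact/measurable_EFinP/measurable_funM.
  - by move=> x; rewrite lee_fin mulr_ge0// ltW.
pose G x := (k x * (phi x)%:E + (I^-1 * r x)%:E)%E.
have kphi0 x : (0 <= k x * (phi x)%:E)%E by rewrite mule_ge0// lee_fin ltW.
have Ir0 x : (0 <= (I^-1 * r x)%:E)%E by rewrite lee_fin mulr_ge0 ?invr_ge0 ?ltW.
have G0 x : (0 <= G x)%E by exact: adde_ge0.
have mkphi : measurable_fun setT (fun x => k x * (phi x)%:E)%E.
  by apply: emeasurable_funM => //; exact/measurable_EFinP.
have mIr : measurable_fun setT (fun x => (I^-1 * r x)%:E)%E.
  by apply/measurable_EFinP; exact: measurable_funM.
have mG : measurable_fun setT G by exact: emeasurable_funD.
have k_fin : (\int[gamma]_x k x)%E \is a fin_num.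
  by rewrite ge0_fin_numE ?integral_ge0// ltey.
have G_int : (\int[mu]_x G x = \int[gamma]_x k x + 1)%E.
  rewrite ge0_integralD// -ge0_integral_gauss//; congr (_ + _)%E.
  under eq_integral do rewrite EFinM.
  rewrite ge0_integralZl//; last 3 first.
  - exact/measurable_EFinP.
  - by move=> x _; rewrite lee_fin ltW.
  - by rewrite lee_fin invr_ge0 ltW.
  by rewrite r_int -EFinM mulVf// gt_eqF.
have iG : mu.-integrable setT G.
  apply/integrableP; split=> //.
  under eq_integral do rewrite gee0_abs//.
  by rewrite G_int -(fineK k_fin) -EFinD ltry.
pose H (x : R) := c * cumul phi x + (d - d ^+ 2) * ((T x - x) * phi x).
have dH (x : R) : is_derive x 1 H (c * phi x + (d - d ^+ 2) * (J x * phi x)).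
  have dc := cumul_is_derive cphi (@gauss_pdf_integrable R) x.
  have dp := gauss_pdf_is_derive x; have dTx := dT x.
  apply: is_derive_eq; rewrite /GRing.scale/= /J /T'; ring.
have cH : continuous (fun x => c * phi x + (d - d ^+ 2) * (J x * phi x)).
  have cT' : continuous T'.
    move=> x; apply: cvgM; first exact: cphi.
    apply: cvgV; first by rewrite gt_eqF.
    by apply: continuous_comp; [exact: cT|exact: cb].
  have cJ : continuous J.
    move=> x; apply: cvgB; first by apply: cvgB; [exact: cT'|exact: cvg_cst].
    by apply: cvgM; [exact: cvg_id|apply: cvgB; [exact: cT|exact: cvg_id]].
  move=> x; apply: cvgD; apply: cvgM; try exact: cvg_cst; first exact: cphi.
  by apply: cvgM; [exact: cJ|exact: cphi].
have bound n : H n%:R - H (- n%:R) <= fine (\int[gamma]_x k x) + 1.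
  rewrite -lee_fin [leRHS]EFinD fineK// -G_int -(integral_derive dH cH); last first.
    by rewrite (@le_trans _ _ 0)// oppr_le0.
  apply: (@le_trans _ _ (\int[mu]_(x in itvN n) G x)%E).
    apply: le_integral => //.
    - apply: continuous_compact_integrable; first exact: segment_compact.
      exact: continuous_subspaceT.
    - exact: integrableS iG.
    - by move=> x _; exact: pointwise.
  by apply: ge0_subset_integral => //; exact: measurable_itv.
have T_ndecr (n : nat) : T (- n%:R) <= T n%:R.
  have := is_derive_gt0_incr dT T'_gt0 n%:R (- n%:R).
  by rewrite leNgt => ->; rewrite -leNgt (@le_trans _ _ 0)// oppr_le0.
pose g (n : nat) := \int[mu]_(x in itvN n) phi x.
have gE (n : nat) : g n = cumul phi n%:R - cumul phi (- n%:R).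
  have dc := cumul_is_derive cphi (@gauss_pdf_integrable R).
  have nn : - n%:R <= n%:R :> R by rewrite (@le_trans _ _ 0)// oppr_le0.
  by have := integral_derive dc cphi nn; rewrite /g /Rintegral /itvN => ->.
(* The boundary terms are at least - D / n, because T is nondecreasing. *)
pose D := (d - d ^+ 2) * 2 * (2 * normal_peak 1).
have lower n : c * g n.+1 - D * harmonic n <= fine (\int[gamma]_x k x) + 1.
  apply: le_trans (bound n.+1); rewrite gE /H.
  have -> : phi (- n.+1%:R) = phi n.+1%:R by rewrite !gauss_pdfE sqrrN.
  have := @sqr_gauss_pdf_le R n.+1%:R.
  have := T_ndecr n.+1; rewrite /D (_ : harmonic n = n.+1%:R^-1)//.
  set N := n.+1%:R; set e := phi N => TN eN.
  have N0 : 0 < N by rewrite ltr0n.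
  have e0 : 0 < e by exact: phi_gt0.
  have dd : 0 < d - d ^+ 2 by rewrite expr2 -{1}[d]mulr1 -mulrBr mulr_gt0// subr_gt0.
  have Ne : N * e <= 2 * normal_peak 1 * N^-1.
    by rewrite ler_pdivlMr// (_ : N * e * N = N ^+ 2 * e)//; ring.
  have Te : 0 <= (T N - T (- N)) * e by rewrite mulr_ge0 ?subr_ge0// ltW.
  have : (d - d ^+ 2) * (2 * (N * e)) <= (d - d ^+ 2) * (2 * (2 * normal_peak 1 * N^-1) + (T N - T (- N)) * e).
    rewrite ler_pM2l//; apply: le_trans (_ : 2 * (2 * normal_peak 1 * N^-1) <= _).
      by rewrite ler_pM2l.
    by rewrite lerDl.
  rewrite -subr_ge0 => le0; rewrite -subr_ge0; apply: le_trans le0 _.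
  by rewrite le_eqVlt; apply/orP; left; apply/eqP; field; rewrite gt_eqF.
have cvg_lower : c * g n.+1 - D * harmonic n @[n --> \oo] --> c * 1 - D * 0.
  apply: cvgB; apply: cvgM; try exact: cvg_cst; last exact: cvg_harmonic.
  by rewrite (cvg_shiftS g); exact: gauss_itv_cvg.
have : c * 1 - D * 0 <= fine (\int[gamma]_x k x) + 1.
  by apply: cvgr_to_le cvg_lower _; exact: nearW.
rewrite mulr1 mulr0 subr0 /c => cle.
by rewrite -(fineK k_fin) lee_fin; lra.
Qed.

End three_functions_gauss.

(** * Induction on the dimension *)

Section std_gaussian_integral.
Context {R : realType}.
Local Notation gamma := (@normal_prob R 0 1).

Lemma cons_rVD n (a b : R) (x y : R) (v w : 'rV[R]_n) :
  cons_rV (a * x + b * y, a *: v + b *: w) =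
  a *: cons_rV (x, v) + b *: cons_rV (y, w).
Proof.
by apply/rowP => i; rewrite !mxE; case: unlift => //= j; rewrite !mxE.
Qed.

Lemma measurable_cons_slice n (x : R) :
  measurable_fun setT (fun v : 'rV[R]_n => cons_rV (x, v)).
Proof.
have := @measurable_cons_rV R n.
move=> mc; apply: (measurableT_comp mc).
exact: measurable_pair1.
Qed.

Lemma ge0_integral_std_gaussianS n (F : 'rV[R]_n.+1 -> \bar R) :
  measurable_fun setT F -> (forall v, (0 <= F v)%E) ->
  (\int[std_gaussian R n.+1]_v F v =
   \int[gamma]_x \int[std_gaussian R n]_v F (cons_rV (x, v)))%E.
Proof.
move=> mF F0; rewrite ge0_integral_distribution//.
rewrite (fubini_tonelli1 (F \o @cons_rV R n))//; last by move=> z; exact: F0.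
by apply: measurableT_comp => //; exact: measurable_cons_rV.
Qed.

Lemma measurable_std_gaussian_slice n (F : 'rV[R]_n.+1 -> \bar R) :
  measurable_fun setT F -> (forall v, (0 <= F v)%E) ->
  measurable_fun (setT : set (measurableTypeR R))
    (fun x => \int[std_gaussian R n]_v F (cons_rV (x, v)))%E.
Proof.
move=> mF F0.
apply: (@measurable_fun_fubini_tonelli_F _ _ _ _ _ (std_gaussian R n) (F \o @cons_rV R n)).
- by apply: measurableT_comp => //; exact: measurable_cons_rV.
- by move=> x; exact: F0.
Qed.

Lemma unit_Rintegral_std_gaussianS n (f : 'rV[R]_n.+1 -> R) :
  measurable_fun setT f -> (forall v, 0 < f v <= 1) ->
  \int[std_gaussian R n.+1]_v f v =
  \int[gamma]_x \int[std_gaussian R n]_v f (cons_rV (x, v)).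
Proof.
move=> mf f01; rewrite /Rintegral ge0_integral_std_gaussianS//.
- congr fine; apply: eq_integral => x _.
  rewrite -unit_RintegralE//; apply: measurableT_comp => //.
  exact: measurable_cons_slice.
- exact/measurable_EFinP.
- by move=> v; rewrite lee_fin ltW//; case/andP: (f01 v).
Qed.

Lemma measurable_unit_slice n (f : 'rV[R]_n.+1 -> R) :
  measurable_fun setT f -> (forall v, 0 < f v <= 1) ->
  measurable_fun (setT : set (measurableTypeR R))
    (fun x => \int[std_gaussian R n]_v f (cons_rV (x, v))).
Proof.
move=> mf f01; apply/measurable_EFinP.
rewrite (_ : _ \o _ = fun x => \int[std_gaussian R n]_v (EFin \o f) (cons_rV (x, v)))%E.
  apply: measurable_std_gaussian_slice; first exact/measurable_EFinP.
  by move=> v; rewrite lee_fin ltW//; case/andP: (f01 v).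
apply/funext => x /=; rewrite unit_RintegralE//; apply: measurableT_comp => //.
exact: measurable_cons_slice.
Qed.

Lemma unit_slice01 n (f : 'rV[R]_n.+1 -> R) :
  measurable_fun setT f -> (forall v, 0 < f v <= 1) ->
  forall x, 0 < \int[std_gaussian R n]_v f (cons_rV (x, v)) <= 1.
Proof.
move=> mf f01 x; apply: unit_Rintegral01 => //.
by apply: measurableT_comp => //; exact: measurable_cons_slice.
Qed.

(** The space [E] is arbitrary so that the induction can move one Gaussian
    coordinate at a time into it. *)
Lemma log_concave_std_gaussian n (E : lmodType R) (g : E * 'rV[R]_n -> R) :
  (forall z, 0 < g z <= 1) -> log_concave g ->
  (forall x, measurable_fun setT (fun v => g (x, v))) ->
  log_concave (fun x => \int[std_gaussian R n]_v g (x, v)).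
Proof.
elim: n E g => [|n IH] E g g01 lg mg.
  move=> x y l l01.
  have g0E z : \int[std_gaussian R 0]_v g (z, v) = g (z, 0).
    by rewrite /Rintegral integral_dirac ?diracT ?mul1e//; exact/measurable_EFinP.
  rewrite !g0E; apply: le_trans (lg _ _ _ l01) _.
  rewrite (_ : _ + _ = ((1 - l) *: x + l *: y, 0) :> E * 'rV[R]_0)//.
  by congr pair; apply/rowP => -[].
pose h (z : (E * R^o) * 'rV[R]_n) := g (z.1.1, cons_rV (z.1.2, z.2)).
have lh : log_concave h.
  move=> z w l l01; apply: le_trans (lg _ _ _ l01) _.
  rewrite /h; set zw := (1 - l) *: z + l *: w.
  have -> // : cons_rV (zw.1.2, zw.2) =
    (1 - l) *: cons_rV (z.1.2, z.2) + l *: cons_rV (w.1.2, w.2).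
  exact: cons_rVD.
have mh z : measurable_fun setT (fun v => h (z, v)).
  by apply: (measurableT_comp (mg z.1)); exact: measurable_cons_slice.
have lH := IH _ h (fun z => g01 _) lh mh.
pose H (z : E * R^o) := \int[std_gaussian R n]_v h (z, v).
have H01 z : 0 < H z <= 1.
  by apply: unit_Rintegral01 => [|v]; [exact: mh|exact: g01].
have gH x : \int[std_gaussian R n.+1]_v g (x, v) =
    \int[gamma]_y H (x, y) by rewrite unit_Rintegral_std_gaussianS.
have cH x : continuous (fun y => H (x, y)).
  apply: log_concave_continuous; first by move=> y; case/andP: (H01 (x, y)).
  move=> y z l l01; have := lH (x, y) (x, z) l l01.
  have -> : (1 - l) *: ((x, y) : E * R^o) + l *: ((x, z) : E * R^o) =
      (x, (1 - l) *: (y : R^o) + l *: (z : R^o)) :> E * R^o.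
    by congr pair => /=; rewrite -scalerDl subrK scale1r.
  by [].
move=> x y l l01; rewrite !gH.
apply: prekopa_gauss_line => //.
- by apply: continuous_measurable_fun; exact: cH.
- by move=> s t; exact: (lH (x, s) (y, t) l l01).
Qed.

(** Integrating out all coordinates but the first turns [p], [k] and [q] into
    functions on the line to which [three_functions_line] applies; they satisfy
    its hypothesis by induction. *)
Lemma three_functions n (d : R) (p q : 'rV[R]_n -> R) (k : 'rV[R]_n -> \bar R) :
  0 < d < 1 -> measurable_fun setT p -> measurable_fun setT q ->
  measurable_fun setT k ->
  (forall x, 0 < p x <= 1) -> (forall x, 0 < q x <= 1) ->
  (forall x, (0 <= k x)%E) -> log_concave q ->
  (forall x y, ((- ln (p ((1 - d) *: x + d *: y)) + d ^+ 2 * ln (q y))%:E <= k x)%E) ->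
  ((- ln (\int[std_gaussian R n]_v p v) + d ^+ 2 * ln (\int[std_gaussian R n]_v q v))%:E <=
   \int[std_gaussian R n]_v k v)%E.
Proof.
move=> d01; elim: n p q k => [|n IH] p q k mp mq mk p01 q01 k0 lq pqk.
  have E0 (f : 'rV[R]_0 -> R) : measurable_fun setT f ->
      \int[std_gaussian R 0]_v f v = f 0.
    move=> mf; rewrite /Rintegral integral_dirac ?diracT ?mul1e//.
    exact/measurable_EFinP.
  rewrite !E0// integral_dirac// diracT mul1e.
  by have := pqk 0 0; rewrite !scaler0 addr0.
rewrite !unit_Rintegral_std_gaussianS// ge0_integral_std_gaussianS//.
apply: three_functions_line => //.
- exact: measurable_unit_slice.
- exact: measurable_std_gaussian_slice.
- exact: unit_slice01.
- exact: unit_slice01.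
- by move=> x; apply: integral_ge0.
- pose g (z : R^o * 'rV[R]_n) := q (cons_rV z).
  apply: (@log_concave_std_gaussian n R^o g) => //.
  + by move=> z; exact: q01.
  + move=> z w l l01; apply: le_trans (lq _ _ _ l01) _.
    rewrite /g; set zw := (1 - l) *: z + l *: w.
    have -> // : cons_rV zw = (1 - l) *: cons_rV z + l *: cons_rV w.
    by case: z @zw => z1 z2; case: w => w1 w2; exact: cons_rVD.
  + by move=> x; apply: (measurableT_comp mq); exact: measurable_cons_slice.
move=> x y; apply: IH => //.
- by apply: (measurableT_comp mp); exact: measurable_cons_slice.
- by apply: (measurableT_comp mq); exact: measurable_cons_slice.
- by apply: (measurableT_comp mk); exact: measurable_cons_slice.
- move=> v w l l01; apply: le_trans (lq _ _ _ l01) _.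
  by rewrite -cons_rVD -mulrDl subrK mul1r.
- by move=> v w; rewrite cons_rVD.
Qed.

End std_gaussian_integral.

(** * Two bounds for the lower tail *)

Section lower_tail.
Context {R : realType} (n : nat).
Local Notation G := (std_gaussian R n).
Variable f : 'rV[R]_n -> R.
Hypothesis mf : measurable_fun setT f.
Hypothesis f_convex : forall x y l, 0 < l < 1 ->
  f ((1 - l) *: x + l *: y) <= (1 - l) * f x + l * f y.

Lemma expR_scale_unit (c y : R) : 0 <= c -> 0 <= y -> 0 < expR (- (c * y)) <= 1.
Proof. by move=> c0 y0; rewrite expR_gt0 expR_le1 oppr_le0 mulr_ge0. Qed.

Lemma measurable_expR_scale (c : R) (g : 'rV[R]_n -> R) :
  measurable_fun setT g -> measurable_fun setT (fun v => expR (- (c * g v))).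
Proof.
move=> mg; apply: measurableT_comp => //; apply: measurableT_comp => //.
exact: measurable_funM.
Qed.

Lemma measure_le_unit_Rintegral (A : set 'rV[R]_n) (q : 'rV[R]_n -> R) :
  measurable A -> measurable_fun setT q -> (forall v, 0 < q v <= 1) ->
  (forall v, A v -> q v = 1) -> (G A <= (\int[G]_v q v)%:E)%E.
Proof.
move=> mA mq q01 qA; rewrite unit_RintegralE//.
have -> : G A = (\int[G]_v (\1_A v)%:E)%E by rewrite integral_indic// setIT.
apply: ge0_le_integral => //.
- by apply/measurable_EFinP; exact: measurable_indic.
- exact/measurable_EFinP.
move=> v _; rewrite lee_fin indicE; have /andP[q0 _] := q01 v.
have [|_] := boolP (v \in A); last exact: ltW.
by rewrite inE => /qA ->.
Qed.

(** In terms of [psi th = ln (E (exp (- th (g - E g))))], this says that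
    [psi th / th ^ 2] is nonincreasing in [th > 0]. *)
Lemma laplace_comparison (g : 'rV[R]_n -> R) (d th : R) : 0 < d < 1 -> 0 < th ->
  measurable_fun setT g -> (forall v, 0 <= g v) -> G.-integrable setT (EFin \o g) ->
  (forall x y l, 0 < l < 1 ->
    g ((1 - l) *: x + l *: y) <= (1 - l) * g x + l * g y) ->
  d ^+ 2 * ln (\int[G]_v expR (- (th / d * g v))) <=
  ln (\int[G]_v expR (- (th * g v))) + th * (1 - d) * \int[G]_v g v.
Proof.
move=> d01 th0 mg g0 ig cg; have [d0 d1] := andP d01.
have c0 : 0 <= th * (1 - d) by rewrite mulr_ge0 ?ltW// subr_gt0.
have thd0 : 0 < th / d by exact: divr_gt0.
pose p v := expR (- (th * g v)); pose q v := expR (- (th / d * g v)).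
have p01 v : 0 < p v <= 1 by apply: expR_scale_unit => //; exact: ltW.
have q01 v : 0 < q v <= 1 by apply: expR_scale_unit => //; exact: ltW.
have mp : measurable_fun setT p by exact: measurable_expR_scale.
have mq : measurable_fun setT q by exact: measurable_expR_scale.
pose k v := ((th * (1 - d) * g v)%:E).
have ck : (\int[G]_v k v = (th * (1 - d) * \int[G]_v g v)%:E)%E.
  rewrite /k; under eq_integral do rewrite EFinM.
  by rewrite integralZl// [RHS]EFinM fineK//; exact: integrable_fin_num.
have : ((- ln (\int[G]_v p v) + d ^+ 2 * ln (\int[G]_v q v))%:E <=
    \int[G]_v k v)%E.
  apply: three_functions => //.
  - by apply/measurable_EFinP; exact: measurable_funM.
  - by move=> v; rewrite lee_fin mulr_ge0.
  - move=> x y l l01; rewrite /q !expRK.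
    have h := cg x y l l01; rewrite -(ler_pM2l thd0) in h.
    by move: h; rewrite -subr_ge0 => h; rewrite -subr_ge0; apply: le_trans h _;
      rewrite le_eqVlt; apply/orP; left; apply/eqP; ring.
  - move=> x y; rewrite /p /q !expRK lee_fin.
    have -> : d ^+ 2 * - (th / d * g y) = - (th * (d * g y)).
      by field; rewrite gt_eqF.
    have h := cg x y d d01; rewrite -(ler_pM2l th0) in h.
    by move: h; rewrite -subr_ge0 => h; rewrite -subr_ge0; apply: le_trans h _;
      rewrite le_eqVlt; apply/orP; left; apply/eqP; ring.
rewrite ck lee_fin /p /q; lra.
Qed.

Section second_moment.
Variables (M b : R).
Hypothesis b0 : 0 < b.
Hypothesis if2 : G.-integrable setT (fun v => ((f v - M) ^+ 2)%:E).
Hypothesis f2 : \int[G]_v ((f v - M) ^+ 2) = b ^+ 2.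

Let integrable_by (g : 'rV[R]_n -> R) (c1 c2 : R) : measurable_fun setT g ->
  (forall v, `|g v| <= c1 + c2 * (f v - M) ^+ 2) ->
  G.-integrable setT (EFin \o g).
Proof.
move=> mg gle.
have ic : G.-integrable setT (EFin \o cst c1) by exact: finite_measure_integrable_cst.
have i2 : G.-integrable setT (fun v => c2%:E * ((f v - M) ^+ 2)%:E)%E.
  exact: integrableZl.
apply: le_integrable (integrableD measurableT ic i2) => //.
  exact/measurable_EFinP.
move=> v _ /=; rewrite lee_fin; apply: le_trans (gle v) _.
exact: ler_norm.
Qed.

Let Rint_affine (c1 c2 : R) :
  \int[G]_v (c1 + c2 * (f v - M) ^+ 2) = c1 + c2 * b ^+ 2.
Proof.
have i2 : G.-integrable setT (EFin \o (fun v => c2 * (f v - M) ^+ 2)).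
  rewrite (_ : _ \o _ = (fun v => c2%:E * ((f v - M) ^+ 2)%:E)%E)//.
  exact: integrableZl.
rewrite RintegralD//; last exact: finite_measure_integrable_cst.
rewrite RintegralZl// f2 Rintegral_cst//.
congr (_ + _); rewrite -[RHS]mulr1; congr (_ * _).
by have := probability_setT G => /(congr1 fine).
Qed.

(** The expansion [exp y <= 1 + y + 2 y ^ 2], valid for [y <= 1/2], controls the
    Laplace transform of [g] at [th] small; [laplace_comparison] transfers the
    bound to [eta = th / d], which is of the order of the optimal Chernoff
    parameter. *)
Lemma lower_tail_far t : b < t ->
  (G [set v | (f v < M - t)%R] <= (expR (- ((t - b) ^+ 2 / (8 * b ^+ 2))))%:E)%E.
Proof.
move=> bt; have t0 : 0 < t by exact: lt_trans bt.
pose g v := Num.max (f v - (M - t)) 0.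
have g0 v : 0 <= g v by rewrite le_max lexx orbT.
have mg : measurable_fun setT g.
  by apply: measurable_funrpos; exact: measurable_funB.
have cg x y l : 0 < l < 1 ->
    g ((1 - l) *: x + l *: y) <= (1 - l) * g x + l * g y.
  move=> l01; have [l0 l1] := andP l01.
  have l1' : 0 < 1 - l by rewrite subr_gt0.
  rewrite ge_max addr_ge0 ?mulr_ge0 ?(ltW l0) ?(ltW l1')// andbT.
  have H1 : (1 - l) * (f x - (M - t)) <= (1 - l) * g x.
    by rewrite ler_pM2l// le_max lexx.
  have H2 : l * (f y - (M - t)) <= l * g y by rewrite ler_pM2l// le_max lexx.
  have := f_convex x y l01; lra.
have gt_le v : `|g v - t| <= `|f v - M|.
  rewrite /g; case: (leP (f v - (M - t)) 0) => h.
    rewrite sub0r normrN gtr0_norm// ler0_norm; lra.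
  by rewrite opprB addrA addrAC addrK.
have gabs v : g v <= t + (f v - M) ^+ 2 / (2 * b) + b / 2 /\
     t - (f v - M) ^+ 2 / (2 * b) - b / 2 <= g v.
  have : `|f v - M| <= (f v - M) ^+ 2 / (2 * b) + b / 2.
    rewrite -(real_normK (num_real (f v - M))) -subr_ge0.
    have -> : `|f v - M| ^+ 2 / (2 * b) + b / 2 - `|f v - M| =
      (`|f v - M| - b) ^+ 2 / (2 * b) by field; rewrite gt_eqF.
    by rewrite divr_ge0 ?sqr_ge0// mulr_ge0// ltW.
  have := gt_le v; rewrite ler_norml => /andP[]; lra.
have ig : G.-integrable setT (EFin \o g).
  apply: (@integrable_by g (t + b / 2) (2 * b)^-1) => // v.
  rewrite ger0_norm//; have [+ _] := gabs v; lra.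
pose m := \int[G]_v g v.
have mtb : t - b <= m.
  have -> : t - b = (t - b / 2) + (- (2 * b)^-1) * b ^+ 2.
    by field; rewrite gt_eqF.
  rewrite -Rint_affine; apply: le_Rintegral => //.
    apply: (@integrable_by _ (t + b / 2) (2 * b)^-1) => [|v].
      apply: measurable_funD => //; apply: measurable_funM => //.
      by apply: measurable_funX; exact: measurable_funB.
    have X0 : 0 <= (2 * b)^-1 * (f v - M) ^+ 2.
      by rewrite mulr_ge0 ?sqr_ge0// invr_ge0 mulr_ge0// ltW.
    rewrite mulNr; move: X0; set X := _ * _ => X0.
    have b2 : 0 <= b / 2 by rewrite divr_ge0// ltW.
    rewrite ler_norml; apply/andP; split; first by rewrite lerNl; lra.
    rewrite -!addrA lerD2l; apply: (@le_trans _ _ 0); last exact: addr_ge0.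
    by rewrite -opprD oppr_le0 addr_ge0.
  move=> v _; have [_ +] := gabs v; lra.
(* eta optimizes the final exponent - eta (t - b) + 2 eta^2 b^2; then d is chosen
   small enough for th * t = d * eta * t to be at most 1/2. *)
pose eta := (t - b) / (4 * b ^+ 2).
have tb0 : 0 < t - b by rewrite subr_gt0.
have b20 : 0 < b ^+ 2 by exact: exprn_gt0.
have eta0 : 0 < eta by rewrite divr_gt0// mulr_gt0.
have et0 : 0 < eta * t by exact: mulr_gt0.
pose d := (2 * (1 + eta * t))^-1.
have d0 : 0 < d by rewrite invr_gt0 mulr_gt0// addr_gt0.
have d1 : d < 1 by rewrite invf_lt1 ?mulr_gt0 ?addr_gt0//; lra.
pose th := d * eta.
have th0 : 0 < th by exact: mulr_gt0.
have tht : th * t <= 2^-1.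
  rewrite /th /d -mulrA mulrC ler_pdivrMr ?mulr_gt0 ?addr_gt0//; lra.
have d01 : 0 < d < 1 by rewrite d0 d1.
have LC := laplace_comparison d01 th0 mg g0 ig cg.
have qE : th / d = eta by rewrite /th mulrC mulKf// gt_eqF.
rewrite qE -/m in LC.
pose p v := expR (- (th * g v)); pose q v := expR (- (eta * g v)).
have p01 v : 0 < p v <= 1 by apply: expR_scale_unit => //; exact: ltW.
have q01 v : 0 < q v <= 1 by apply: expR_scale_unit => //; exact: ltW.
have mp : measurable_fun setT p by exact: measurable_expR_scale.
have mq : measurable_fun setT q by exact: measurable_expR_scale.
have /andP[Ip0 _] := unit_Rintegral01 G mp p01.
have /andP[Iq0 _] := unit_Rintegral01 G mq q01.
have expR_le2 (y : R) : y <= 2^-1 -> expR y <= 1 + y + 2 * y ^+ 2.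
  move=> y2; have y1 : 0 < 1 - y by lra.
  apply: (@le_trans _ _ (1 - y)^-1).
    rewrite -[y]opprK expRN lef_pV2 ?posrE ?expR_gt0 ?opprK//.
    exact: expR_ge1Dx.
  rewrite -(@ler_pM2r _ (1 - y))// mulVf ?gt_eqF//.
  have : 0 <= y ^+ 2 * (1 - 2 * y) by rewrite mulr_ge0 ?sqr_ge0//; lra.
  lra.
have Ip : \int[G]_v p v <= expR (- (th * m) + 2 * th ^+ 2 * b ^+ 2).
  pose h v := (1 + th * t + 2 * th ^+ 2 * (f v - M) ^+ 2) - th * g v.
  have mh1 : measurable_fun setT (fun v => 1 + th * t + 2 * th ^+ 2 * (f v - M) ^+ 2).
    apply: measurable_funD => //; apply: measurable_funM => //.
    by apply: measurable_funX; exact: measurable_funB.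
  have ih1 : G.-integrable setT
      (EFin \o (fun v => 1 + th * t + 2 * th ^+ 2 * (f v - M) ^+ 2)).
    apply: (@integrable_by _ (1 + th * t) (2 * th ^+ 2)) => // v.
    have tht0 : 0 <= th * t by rewrite mulr_ge0// ltW.
    rewrite ger0_norm// addr_ge0 ?addr_ge0//.
    by apply: mulr_ge0; [apply: mulr_ge0 => //|]; exact: sqr_ge0.
  have ih2 : G.-integrable setT (EFin \o (fun v => th * g v)).
    rewrite (_ : _ \o _ = (fun v => th%:E * (EFin \o g) v)%E)//.
    exact: integrableZl.
  have ih : G.-integrable setT (EFin \o h).
    by have := integrableB measurableT ih1 ih2; apply: eq_integrable.
  have hE : \int[G]_v h v = 1 + (th * t - th * m + 2 * th ^+ 2 * b ^+ 2).
    rewrite /h RintegralB// Rint_affine RintegralZl//; rewrite -/m; ring.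
  apply: (@le_trans _ _ (\int[G]_v (expR (- (th * t)) * h v))).
    apply: le_Rintegral => //; first exact: unit_integrable.
      rewrite (_ : _ \o _ = (fun v => (expR (- (th * t)))%:E * (EFin \o h) v)%E)//.
      exact: integrableZl.
    move=> v _; rewrite /p.
    have -> : - (th * g v) = - (th * t) + - (th * (g v - t)) by ring.
    rewrite expRD ler_pM2l ?expR_gt0//.
    have y2 : - (th * (g v - t)) <= 2^-1.
      apply: le_trans tht; rewrite -mulrN ler_pM2l// opprB lerBlDr lerDl.
      exact: g0.
    apply: (le_trans (expR_le2 _ y2)); rewrite /h.
    have gf2 : (g v - t) ^+ 2 <= (f v - M) ^+ 2.
      rewrite -(real_normK (num_real (g v - t))).
      by rewrite -(real_normK (num_real (f v - M))) ler_sqr ?nnegrE.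
    rewrite sqrrN exprMn mulrA.
    have : 2 * th ^+ 2 * (g v - t) ^+ 2 <= 2 * th ^+ 2 * (f v - M) ^+ 2.
      by rewrite ler_pM2l// mulr_gt0// exprn_gt0.
    lra.
  rewrite RintegralZl// hE.
  have -> : - (th * m) + 2 * th ^+ 2 * b ^+ 2 = - (th * t) +
      (th * t - th * m + 2 * th ^+ 2 * b ^+ 2) by ring.
  by rewrite expRD ler_pM2l ?expR_gt0// expR_ge1Dx.
have lnp : ln (\int[G]_v p v) <= - (th * m) + 2 * th ^+ 2 * b ^+ 2.
  by rewrite -[leRHS]expRK ler_ln ?posrE ?expR_gt0.
have mA : measurable [set v | f v < M - t].
  rewrite (_ : [set v | _] = setT `&` f @^-1` `]-oo, M - t[); first exact: mf.
  by rewrite setTI; apply/seteqP; split => v; rewrite /= in_itv.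
apply: (le_trans (measure_le_unit_Rintegral mA mq q01 _)).
  move=> v /= fv; rewrite /q /g.
  have -> : Num.max (f v - (M - t)) 0 = 0 by apply/max_idPr; lra.
  by rewrite mulr0 oppr0 expR0.
rewrite lee_fin -ler_ln ?posrE ?expR_gt0// expRK.
have d20 : 0 < d ^+ 2 by exact: exprn_gt0.
rewrite -(ler_pM2l d20); apply: (le_trans LC).
have -> : (t - b) ^+ 2 / (8 * b ^+ 2) = eta * (t - b) - 2 * eta ^+ 2 * b ^+ 2.
  by rewrite /eta; field; rewrite gt_eqF.
have : d * th * (t - b) <= d * th * m by rewrite ler_pM2l// mulr_gt0.
move: lnp; rewrite /th; lra.
Qed.

(** As [N] grows, the integrand decreases to the indicator of [f <= s]; keeping [N]
    finite makes it positive, as required by [log_concave]. *)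
Lemma log_concave_soft_sublevel (N : R) : 0 <= N ->
  @log_concave R R^o
    (fun s => \int[G]_v expR (- (N * Num.max (f v - s) 0))).
Proof.
move=> N0.
pose g (z : R^o * 'rV[R]_n) := expR (- (N * Num.max (f z.2 - z.1) 0)).
apply: (@log_concave_std_gaussian R n R^o g).
- by move=> z; apply: expR_scale_unit => //; rewrite le_max lexx orbT.
- move=> z w l l01; rewrite /g !expRK.
  have -> : (1 - l) * - (N * Num.max (f z.2 - z.1) 0) +
      l * - (N * Num.max (f w.2 - w.1) 0) =
    - (N * ((1 - l) * Num.max (f z.2 - z.1) 0 + l * Num.max (f w.2 - w.1) 0)).
    by ring.
  rewrite lerN2 ler_wpM2l//.
  have [l0 l1] := andP l01.
  have l1' : 0 < 1 - l by rewrite subr_gt0.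
  rewrite ge_max; apply/andP; split; last first.
    by rewrite addr_ge0// mulr_ge0 ?(ltW l0) ?(ltW l1')// le_max lexx orbT.
  have H1 : (1 - l) * (f z.2 - z.1) <= (1 - l) * Num.max (f z.2 - z.1) 0.
    by rewrite ler_pM2l// le_max lexx.
  have H2 : l * (f w.2 - w.1) <= l * Num.max (f w.2 - w.1) 0.
    by rewrite ler_pM2l// le_max lexx.
  have H3 := f_convex z.2 w.2 l01.
  rewrite /= /GRing.scale/=.
  apply: (@le_trans _ _ ((1 - l) * (f z.2 - z.1) + l * (f w.2 - w.1))); last first.
    exact: lerD.
  have -> : (1 - l) * (f z.2 - z.1) + l * (f w.2 - w.1) =
    (1 - l) * f z.2 + l * f w.2 - ((1 - l) * z.1 + l * w.1) by ring.
  by rewrite lerD2r.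
- move=> x; apply: measurable_expR_scale.
  by apply: measurable_funrpos; exact: measurable_funB.
Qed.

Lemma measurable_sublevel s : measurable [set v | f v < s].
Proof.
rewrite (_ : [set v | _] = setT `&` f @^-1` `]-oo, s[); first exact: mf.
by rewrite setTI; apply/seteqP; split => v; rewrite /= in_itv.
Qed.

(** Compare the (softened) distribution function at [M - t], [M - e] and
    [M + 2 b], where it is respectively at least the probability to be bounded,
    at most about [1/2], and at least [3/4]; then let [e] tend to [0]. *)
Lemma lower_tail_near t : 0 < t -> (G [set v | (f v < M)%R] <= (2^-1)%:E)%E ->
  (G [set v | (f v < M - t)%R] <= (2^-1 * expR (- (t / (6 * b))))%:E)%E.
Proof.
move=> t0 med.
have b20 : 0 < b ^+ 2 by exact: exprn_gt0.
have tb0 : 0 < t + 2 * b by rewrite addr_gt0// mulr_gt0.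
set A := [set v | f v < M - t].
have mA : measurable A by exact: measurable_sublevel.
pose alpha := fine (G A).
have GA : G A = alpha%:E by rewrite /alpha fineK// fin_num_measure.
rewrite GA lee_fin.
have [a0|a0] := leP alpha 0.
  by apply: (le_trans a0); rewrite mulr_ge0 ?expR_ge0// invr_ge0.
pose g (N s : R) v := expR (- (N * Num.max (f v - s) 0)).
pose H N s := \int[G]_v g N s v.
have mg N s : measurable_fun setT (g N s).
  apply: measurable_expR_scale.
  by apply: measurable_funrpos; exact: measurable_funB.
have g01 N s v : 0 <= N -> 0 < g N s v <= 1.
  by move=> N0; apply: expR_scale_unit => //; rewrite le_max lexx orbT.
have g1 N s v : f v <= s -> g N s v = 1.
  move=> fs; rewrite /g.
  have -> : Num.max (f v - s) 0 = 0 by apply/max_idPr; rewrite subr_le0.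
  by rewrite mulr0 oppr0 expR0.
have Hlow N : 0 <= N -> alpha <= H N (M - t).
  move=> N0; rewrite -lee_fin -GA; apply: measure_le_unit_Rintegral => //.
    by move=> v; exact: g01.
  by move=> v /= /ltW; exact: g1.
(* Chebyshev's inequality, in the form 1 - (f - M)^2 / (4 b^2) <= g. *)
have Hup N : 0 <= N -> 3 / 4 <= H N (M + 2 * b).
  move=> N0.
  have -> : 3 / 4 = 1 + (- (4 * b ^+ 2)^-1) * b ^+ 2 :> R.
    by field; rewrite gt_eqF.
  rewrite -Rint_affine; apply: le_Rintegral => //.
  - apply: (@integrable_by _ 1 (4 * b ^+ 2)^-1) => [|v].
      apply: measurable_funD => //; apply: measurable_funM => //.
      by apply: measurable_funX; exact: measurable_funB.
    rewrite mulNr; apply: (le_trans (ler_normB _ _)).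
    rewrite normr1 lerD2l ger0_norm// mulr_ge0 ?sqr_ge0//.
    by rewrite invr_ge0 mulr_ge0// ltW.
  - by apply: unit_integrable => // v; exact: g01.
  move=> v _; rewrite mulNr.
  have [fv|fv] := leP (f v) (M + 2 * b).
    rewrite g1// gerDl oppr_le0 mulr_ge0 ?sqr_ge0// invr_ge0 mulr_ge0//.
    exact: ltW.
  have /andP[gv _] := g01 N (M + 2 * b) v N0.
  apply: le_trans (ltW gv); rewrite subr_le0 mulrC ler_pdivlMr ?mulr_gt0//.
  rewrite mul1r.
  have : 0 <= (f v - M - 2 * b) * (f v - M + 2 * b).
    by apply: mulr_ge0; move: b0; lra.
  lra.
have Hmid N e : 0 <= N -> 0 < e -> H N (M - e) <= 2^-1 + expR (- (N * e)).
  move=> N0 e0; rewrite -lee_fin unit_RintegralE//; last by move=> v; exact: g01.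
  have mB : measurable [set v | f v < M] by exact: measurable_sublevel.
  apply: (@le_trans _ _ (\int[G]_v ((\1_[set v | f v < M] v)%:E + (expR (- (N * e)))%:E)))%E.
    apply: ge0_le_integral => //.
    - by move=> v _; rewrite lee_fin ltW//; case/andP: (g01 N (M - e) v N0).
    - exact/measurable_EFinP.
    - apply: emeasurable_funD => //; apply/measurable_EFinP.
      exact: measurable_indic.
    move=> v _; rewrite -EFinD lee_fin indicE.
    have [|] := boolP (v \in [set v | f v < M]).
      move=> _; have /andP[_ g1'] := g01 N (M - e) v N0.
      by apply: (le_trans g1'); rewrite lerDl expR_ge0.
    rewrite notin_setE /= => /negP; rewrite -leNgt => Mf.
    rewrite add0r /g ler_expR lerN2 ler_wpM2l//.
    by rewrite le_max; apply/orP; left; lra.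
  rewrite ge0_integralD//; last first.
    by apply/measurable_EFinP; exact: measurable_indic.
  rewrite integral_indic// setIT integral_cst// EFinD leeD//.
  rewrite -[leRHS]mule1 lee_wpmul2l ?lee_fin ?expR_ge0//.
  exact: probability_le1.
(* The limit N -> oo, at M - e = (1 - l) (M - t) + l (M + 2 b). *)
have key e : 0 < e < t ->
    (2 * b + e) * ln alpha + (t - e) * ln (3 / 4) <= (t + 2 * b) * - ln 2.
  move=> /andP[e0 et]; pose l := (t - e) / (t + 2 * b).
  have l01 : 0 < l < 1.
    rewrite /l divr_gt0 ?subr_gt0//= ltr_pdivrMr// mul1r; move: b0; lra.
  have [l0 l1] := andP l01.
  have lE : (1 - l) * ln alpha + l * ln (3 / 4) =
      ((2 * b + e) * ln alpha + (t - e) * ln (3 / 4)) / (t + 2 * b).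
    by rewrite /l; field; rewrite gt_eqF.
  rewrite [leRHS]mulrC -ler_pdivrMr// -lE.
  set X := _ + _.
  suff : expR X <= 2^-1 by rewrite -lnV ?posrE// -ler_ln ?posrE ?expR_gt0// expRK.
  have XN (N : nat) : expR X <= 2^-1 + expR (- (N%:R * e)).
    have N0 : 0 <= N%:R :> R by [].
    apply: le_trans (Hmid _ _ N0 e0).
    have H0 s : 0 < H N%:R s.
      have /andP[] // := unit_Rintegral01 G (mg N%:R s) (fun v => g01 _ s v N0).
    rewrite -[leRHS]lnK ?posrE// ler_expR.
    have := @log_concave_soft_sublevel N%:R N0 (M - t) (M + 2 * b) l l01.
    rewrite -/(H _ _) -/(H _ _).
    have -> : (1 - l) *: (M - t : R^o) + l *: (M + 2 * b : R^o) = M - e.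
      by rewrite /GRing.scale/= /l; field; rewrite gt_eqF.
    rewrite -/(H _ _); apply: le_trans; apply: lerD.
      by rewrite ler_pM2l ?subr_gt0// ler_ln ?posrE//; exact: Hlow.
    by rewrite ler_pM2l// ler_ln ?posrE//; exact: Hup.
  rewrite leNgt; apply/negP => hX.
  pose x := expR X - 2^-1; have x0 : 0 < x by rewrite subr_gt0.
  pose N := Num.bound (x * e)^-1.
  have /ltW hN : (x * e)^-1 < N%:R by exact: unstable.ltr_bound.
  have := XN N; rewrite leNgt => /negP; apply.
  rewrite -ltrBrDl -/x expRN invf_plt ?posrE ?expR_gt0//.
  apply: (lt_le_trans _ (expR_ge1Dx _)).
  apply: (@le_lt_trans _ _ (N%:R * e)); last by rewrite ltrDr.
  by rewrite -ler_pdivrMr// -invfM.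
(* The limit e -> 0. *)
have key0 : 2 * b * ln alpha + t * ln (3 / 4) <= (t + 2 * b) * - ln 2.
  rewrite leNgt; apply/negP => h.
  pose C := ln (3 / 4) - ln alpha.
  pose D := 2 * b * ln alpha + t * ln (3 / 4) - (t + 2 * b) * - ln 2.
  have D0 : 0 < D by rewrite subr_gt0.
  have C0 : 0 < `|C| + 1 by rewrite ltr_wpDl.
  pose e := Num.min (t / 2) (D / (2 * (`|C| + 1))).
  have e0 : 0 < e by rewrite lt_min !divr_gt0// mulr_gt0.
  have et : e < t.
    by apply: (@le_lt_trans _ _ (t / 2)); [rewrite ge_min lexx|lra].
  have := key e; rewrite e0 et => /(_ isT).
  have eD : e * C <= D / 2.
    apply: (@le_trans _ _ (e * (`|C| + 1))).
      by rewrite ler_pM2l//; apply: (le_trans (ler_norm C)); rewrite lerDl.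
    rewrite -ler_pdivlMr//; apply: (@le_trans _ _ (D / (2 * (`|C| + 1)))).
      by rewrite ge_min lexx orbT.
    by rewrite le_eqVlt; apply/orP; left; apply/eqP; field; rewrite gt_eqF.
  move: eD D0; rewrite /C /D; lra.
rewrite -ler_ln ?posrE ?mulr_gt0 ?expR_gt0// lnM ?posrE ?expR_gt0// expRK lnV ?posrE//.
have ln34 : 3^-1 - ln 2 <= ln (3 / 4) :> R.
  have -> : 3 / 4 = (3 / 2) * 2^-1 :> R by field.
  rewrite lnM ?posrE ?divr_gt0 ?invr_gt0// lnV ?posrE//.
  rewrite lerD2r.
  have := @le_ln1Dx R (- 3^-1).
  have -> : 1 + - 3^-1 = (3 / 2)^-1 :> R by field.
  rewrite lnV ?posrE ?divr_gt0// ltrN2 invf_lt1// ltr1n => /(_ isT).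
  by rewrite lerNl opprK.
have : t * (3^-1 - ln 2) <= t * ln (3 / 4) by rewrite ler_pM2l.
move=> h; have b20' : 0 < 2 * b by rewrite mulr_gt0.
rewrite -(ler_pM2l b20').
have -> : 2 * b * (- ln 2 - t / (6 * b)) = - (2 * b * ln 2) - t * 3^-1.
  by field; rewrite gt_eqF.
lra.
Qed.

(** The exponential bound serves for [t <= 5 b] and the Gaussian one beyond; the
    constant [3/128] leaves room for both. *)
Lemma lower_tail t : 0 < t -> (G [set v | (f v < M)%R] <= (2^-1)%:E)%E ->
  (G [set v | (f v < M - t)%R] <=
    (2^-1 * expR (- (3 / 128 * (t ^+ 2 / b ^+ 2))))%:E)%E.
Proof.
move=> t0 med; pose x := t / b.
have x0 : 0 < x by exact: divr_gt0.
have tE : t = x * b by rewrite /x divfK// gt_eqF.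
have -> : t ^+ 2 / b ^+ 2 = x ^+ 2 by rewrite tE; field; rewrite gt_eqF.
have [x5|x5] := leP x 5.
  apply: (le_trans (lower_tail_near t0 med)); rewrite lee_fin ler_pM2l ?invr_gt0//.
  have -> : t / (6 * b) = x / 6 by rewrite tE; field; rewrite gt_eqF.
  rewrite ler_expR lerN2.
  have : 0 <= x * (5 - x) by rewrite mulr_ge0 ?subr_ge0// ltW.
  lra.
have bt : b < t by rewrite tE -subr_gt0 -{2}[b]mul1r -mulrBl mulr_gt0//; lra.
apply: (le_trans (lower_tail_far bt)); rewrite lee_fin.
have -> : (t - b) ^+ 2 / (8 * b ^+ 2) = (x - 1) ^+ 2 / 8.
  by rewrite tE; field; rewrite gt_eqF.
have e2 : expR (- 1) <= 2^-1 :> R.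
  by rewrite expRN lef_pV2 ?posrE ?expR_gt0//; apply: le_trans (expR_ge1Dx 1); lra.
apply: (@le_trans _ _ (expR (- 1) * expR (- (3 / 128 * x ^+ 2)))); last first.
  by rewrite ler_pM2r// expR_gt0.
rewrite -expRD ler_expR.
have : 0 <= (x - 5) * x by apply: mulr_ge0; lra.
lra.
Qed.

End second_moment.

End lower_tail.

(** * Second moments around a median *)

Section median_second_moment.
Context d (T : measurableType d) (R : realType) (P : probability T R).
Variable X : T -> R.
Hypothesis mX : measurable_fun setT X.

Lemma measurable_sqr_dev c : measurable_fun setT (fun x => (X x - c) ^+ 2).
Proof. by apply: measurable_funX; exact: measurable_funB. Qed.

Lemma measurable_ge M : measurable [set x | M <= X x].
Proof.
rewrite (_ : [set x | _] = setT `&` X @^-1` `[M, +oo[); first exact: mX.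
by rewrite setTI; apply/seteqP; split => x; rewrite /= in_itv/= andbT.
Qed.

Lemma measurable_le M : measurable [set x | X x <= M].
Proof.
rewrite (_ : [set x | _] = setT `&` X @^-1` `]-oo, M]); first exact: mX.
by rewrite setTI; apply/seteqP; split => x; rewrite /= in_itv.
Qed.

Lemma is_median_lt M : is_median P X M ->
  (P [set x | (X x < M)%R] <= (2^-1)%:E)%E.
Proof.
have CE : [set x | X x < M] = ~` [set x | M <= X x].
  by apply/seteqP; split => x /=; rewrite ltNge => /negP.
move=> [_]; rewrite CE (probability_setC P (measurable_ge M)).
have /fineK <- := fin_num_measure P _ (measurable_ge M).
by rewrite -EFinB !lee_fin; lra.
Qed.

Hypothesis iX : forall c, P.-integrable setT (fun x => ((X x - c) ^+ 2)%:E).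

Lemma sqr_devE c :
  ((\int[P]_x ((X x - c) ^+ 2))%:E = \int[P]_x ((X x - c) ^+ 2)%:E)%E.
Proof. by rewrite fineK//; exact: integrable_fin_num (iX c). Qed.

Lemma sqr_dev_markov (A : set T) (c e : R) : measurable A -> 0 <= e ->
  (forall x, A x -> e <= (X x - c) ^+ 2) ->
  (e%:E * P A <= (\int[P]_x ((X x - c) ^+ 2))%:E)%E.
Proof.
move=> mA e0 Ae; rewrite sqr_devE.
rewrite -[X in (_ * X)%E](_ : \int[P]_x (\1_A x)%:E = _)%E; last first.
  by rewrite integral_indic// setIT.
rewrite -ge0_integralZl//; last first.
  by apply/measurable_EFinP; exact: measurable_indic.
apply: ge0_le_integral => //.
- by move=> x _; rewrite mule_ge0.
- by apply: emeasurable_funM => //; apply/measurable_EFinP; exact: measurable_indic.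
- by apply/measurable_EFinP; exact: measurable_sqr_dev.
move=> x _; rewrite -EFinM lee_fin indicE.
have [|_] := boolP (x \in A); last by rewrite mulr0 sqr_ge0.
by rewrite inE mulr1; exact: Ae.
Qed.

(** Half of the mass lies on the side of [M] away from [c], where the deviation
    from [c] is at least [`|M - c|]; Markov's inequality does the rest. *)
Lemma sqr_median_dev (M c : R) : is_median P X M ->
  (M - c) ^+ 2 <= 2 * \int[P]_x ((X x - c) ^+ 2).
Proof.
move=> [medle medge].
have half (A : set T) : measurable A -> ((2^-1)%:E <= P A)%E ->
    (forall x, A x -> (M - c) ^+ 2 <= (X x - c) ^+ 2) ->
    (M - c) ^+ 2 <= 2 * \int[P]_x ((X x - c) ^+ 2).
  move=> mA PA H; have h := sqr_dev_markov mA (sqr_ge0 _) H.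
  suff : (M - c) ^+ 2 * 2^-1 <= \int[P]_x ((X x - c) ^+ 2).
    by rewrite ler_pdivrMr// mulrC.
  rewrite -lee_fin EFinM; apply: le_trans h.
  by rewrite lee_wpmul2l// lee_fin sqr_ge0.
have [Mc|Mc] := leP c M.
- apply: half (measurable_ge M) medge _ => x /= Xx.
  by rewrite ler_sqr ?nnegrE; lra.
- apply: half (measurable_le M) medle _ => x /= Xx.
  by rewrite -sqrrN -[leRHS]sqrrN ler_sqr ?nnegrE; lra.
Qed.

(** From [(X - M) ^ 2 <= 2 (X - c) ^ 2 + 2 (M - c) ^ 2]; for [c] the mean the
    integral on the right is the variance. *)
Lemma sqr_dev_median_le (M c : R) : is_median P X M ->
  \int[P]_x ((X x - M) ^+ 2) <= 6 * \int[P]_x ((X x - c) ^+ 2).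
Proof.
move=> /(@sqr_median_dev _ c) Mc.
have msq a : measurable_fun setT (fun x => ((X x - a) ^+ 2)%:E).
  by apply/measurable_EFinP; exact: measurable_sqr_dev.
have : ((\int[P]_x ((X x - M) ^+ 2))%:E <=
    (2 * \int[P]_x ((X x - c) ^+ 2) + 2 * (M - c) ^+ 2)%:E)%E.
  rewrite EFinD EFinM !sqr_devE.
  rewrite -ge0_integralZl//; last by move=> x _; rewrite lee_fin sqr_ge0.
  have -> : (2 * (M - c) ^+ 2)%:E = (\int[P]_x cst (2 * (M - c) ^+ 2)%:E x)%E.
    by rewrite integral_cst//; have /= -> := probability_setT P; rewrite mule1.
  rewrite -ge0_integralD//; last 3 first.
  - by move=> x _; rewrite mule_ge0// lee_fin sqr_ge0.
  - by apply: emeasurable_funM.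
  - by move=> x _; rewrite lee_fin mulr_ge0// sqr_ge0.
  apply: ge0_le_integral => //.
  - by move=> x _; rewrite lee_fin sqr_ge0.
  - by apply: emeasurable_funD => //; apply: emeasurable_funM.
  move=> x _; rewrite /= -EFinM -EFinD lee_fin.
  have : 0 <= (X x - c + (M - c)) ^+ 2 by exact: sqr_ge0.
  lra.
by rewrite lee_fin; lra.
Qed.

End median_second_moment.

Section transfer_to_gaussian.
Context (R : realType) (n : nat) d (T : measurableType d) (P : probability T R).
Variable Z : {RV P >-> 'rV[R]_n}.
Hypothesis hZ : std_gaussian_vector Z.

Lemma ge0_integral_std_gaussian_vector (h : 'rV[R]_n -> \bar R) :
  measurable_fun setT h -> (forall v, (0 <= h v)%E) ->
  (\int[P]_x h (Z x) = \int[std_gaussian R n]_v h v)%E.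
Proof.
move=> mh h0; rewrite -(@ge0_integral_distribution _ _ _ _ _ P Z)//.
by apply: eq_measure_integral => A mA _; exact: hZ.
Qed.

Lemma is_median_std_gaussian_vector (f : 'rV[R]_n -> R) (M : R) :
  measurable_fun setT f -> is_median P (f \o Z) M ->
  is_median (std_gaussian R n) f M.
Proof.
move=> mf [medle medge].
have PG (A : set 'rV[R]_n) : measurable A -> P (Z @^-1` A) = std_gaussian R n A.
  exact: hZ.
by split; rewrite -PG; [exact: medle|exact: measurable_le|
  exact: medge|exact: measurable_ge].
Qed.

Lemma variance_std_gaussian_vector (f : 'rV[R]_n -> R) :
  measurable_fun setT f ->
  ('V_P[f \o Z] =
   \int[std_gaussian R n]_v ((f v - fine 'E_P[f \o Z]) ^+ 2)%:E)%E.
Proof.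
move=> mf; rewrite /variance covariance.unlock.
set m := fine _; rewrite expectation.unlock.
rewrite -(ge0_integral_std_gaussian_vector (h := fun v => ((f v - m) ^+ 2)%:E)).
- by apply: eq_integral => w _; rewrite expr2.
- by apply/measurable_EFinP; exact: measurable_sqr_dev.
- by move=> v; rewrite lee_fin sqr_ge0.
Qed.

End transfer_to_gaussian.

Lemma integrable_sqr_dev (R : realType) d (T : measurableType d)
    (P : probability T R) (f : T -> R) (c : R) :
  f \in Lfun P 2%:E -> P.-integrable setT (fun v => ((f v - c) ^+ 2)%:E).
Proof.
move=> f2; have mf : measurable_fun setT f.
  by have := sub_Lfun_mfun f2; rewrite inE.
have i2 : P.-integrable setT
    (fun v => 2%:E * (EFin \o (fun v => f v ^+ 2)%R) v)%E.
  by apply: integrableZl => //; exact: Lfun2_integrable_sqr.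
have ic : P.-integrable setT (EFin \o cst (2 * c ^+ 2)).
  exact: finite_measure_integrable_cst.
apply: le_integrable (integrableD measurableT i2 ic) => //.
  by apply/measurable_EFinP; exact: measurable_sqr_dev.
move=> v _ /=; rewrite lee_fin ger0_norm ?sqr_ge0//.
apply: le_trans (ler_norm _).
have : 0 <= (f v + c) ^+ 2 by exact: sqr_ge0.
lra.
Qed.

(** * The deviation inequality *)

(* The exponent is computed in the extended reals, where t ^ 2 / 0 = +oo and
   expeR -oo = 0, so the bound reads 0 when f(Z) has variance 0. *)
Theorem mainTheorem1 (R : realType) (n : nat) (hn : (1 <= n)%N)
    (d : measure_display) (T : measurableType d) (P : probability T R)
    (Z : {RV P >-> 'rV[R]_n}) (hZ : std_gaussian_vector Z)
    (f : 'rV[R]_n -> R) (f_convex : convex_function setT f)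
    (f_L2 : f \in Lfun (std_gaussian R n) 2%:E)
    (M : R) (hM : is_median P (f \o Z) M)
    (t : R) (ht : 0 < t) :
  (P [set x | (f (Z x) - M < - t)%R] <=
   (2^-1)%:E *
     expeR (- ((pi / 1024)%:E * ((t ^+ 2)%:E / 'V_P[f \o Z]))))%E.
Proof.
pose G := std_gaussian R n.
have mf : measurable_fun setT f.
  by have := sub_Lfun_mfun f_L2; rewrite inE.
have cvx x y l : 0 < l < 1 ->
    f ((1 - l) *: x + l *: y) <= (1 - l) * f x + l * f y.
  move=> /andP[l0 l1].
  have h : f (l *: y + (1 - l) *: x) <= l * f y + (1 - l) * f x.
    by apply: (f_convex (Itv01 (ltW l0) (ltW l1)) y x); rewrite inE.
  by rewrite [X in f X]addrC [leRHS]addrC.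
have isq c := integrable_sqr_dev c f_L2.
have med : is_median G f M by exact: is_median_std_gaussian_vector hM.
pose m := fine 'E_P[f \o Z].
pose s2 := \int[G]_v ((f v - m) ^+ 2).
pose b2 := \int[G]_v ((f v - M) ^+ 2).
rewrite (variance_std_gaussian_vector hZ mf) -sqr_devE// -/m -/s2.
have b2s2 : b2 <= 6 * s2 by exact: sqr_dev_median_le.
have b2_ge0 : 0 <= b2 by apply: Rintegral_ge0 => v _; exact: sqr_ge0.
have mA : measurable [set v | f v < M - t] by exact: measurable_sublevel.
have -> : [set x | f (Z x) - M < - t] = Z @^-1` [set v | f v < M - t].
  by apply/seteqP; split => x /=; rewrite ltrBlDl.
have -> : P (Z @^-1` [set v | f v < M - t]) = G [set v | f v < M - t].
  exact: hZ.
have [b20|b2_gt0] := leP b2 0.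
  (* f is almost surely equal to M, so the tail event is negligible. *)
  have b2E : b2 = 0 by apply/eqP; rewrite eq_le b20 b2_ge0.
  have t2A v : [set v | f v < M - t] v -> t ^+ 2 <= (f v - M) ^+ 2.
    by move=> /= fv; rewrite -[leRHS]sqrrN ler_sqr ?nnegrE; lra.
  have := sqr_dev_markov mf isq mA (sqr_ge0 t) t2A; rewrite -/b2 b2E.
  rewrite pmule_rle0 ?lte_fin ?exprn_gt0// => GA0.
  by apply: (le_trans GA0); rewrite mule_ge0 ?expeR_ge0// lee_fin invr_ge0.
pose b := Num.sqrt b2.
have b0 : 0 < b by rewrite sqrtr_gt0.
have bE : b2 = b ^+ 2 by rewrite sqr_sqrtr.
have s2_gt0 : 0 < s2 by move: b2s2 b2_gt0; lra.
apply: (le_trans (lower_tail mf cvx b0 (isq M) bE ht (is_median_lt mf med))).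
have -> : (- ((pi / 1024)%:E * ((t ^+ 2)%:E / s2%:E)) =
    (- (pi / 1024 * (t ^+ 2 / s2)))%:E)%E.
  by rewrite inver gt_eqF.
rewrite -EFinM lee_fin ler_pM2l ?invr_gt0//.
rewrite ler_expR lerN2 -bE.
have pi4 : (pi : R) < 4 by have := @pihalf_lt2 R; lra.
(* 3/128 = 4 * 6 / 1024: pi is at most 4 and b2 is at most 6 * s2. *)
have -> : pi / 1024 * (t ^+ 2 / s2) =
    (pi / 4 * (b2 / (6 * s2))) * (3 / 128 * (t ^+ 2 / b2)).
  by field; rewrite !gt_eqF.
apply: ler_piMl; first by rewrite ltW// mulr_gt0// divr_gt0 ?exprn_gt0.
apply: mulr_ile1.
- by rewrite divr_ge0// pi_ge0.
- by rewrite ltW// divr_gt0// mulr_gt0.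
- by rewrite ler_pdivrMr// mul1r ltW.
- by rewrite ler_pdivrMr ?mulr_gt0// mul1r.
Qed.
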